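(* Let $1<p<\infty$, let $\lambda_1,\dots,\lambda_N>0$ with $\sum_{i=1}^N\lambda_i=1$. For any $\mu_1,\dots,\mu_N\in\mathcal P_p(\mathbb R^d)$ we have $$\min_{\gamma\in\Pi(\mu_1,\dots,\mu_N)}\int_{\mathbb R^{Nd}}c_p(x_1,\dots,x_N)\,\mathrm d\gamma(x_1,\dots,x_N)=\min_{\nu\in\mathcal P_p(\mathbb R^d)}\sum_{i=1}^N\lambda_iW_p^p(\mu_i,\nu).$$ Moreover, $\nu_p$ is a minimizer for the problem on the right-hand side if and only if $\nu_p=(\overline x_p)_\sharp\gamma_p$ for some minimizer $\gamma_p$ of the problem on the left-hand side.
   Context: $\mathcal P_p(\mathbb R^d)$ is the set of Borel probability measures on $\mathbb R^d$ with finite $p$-th moment. $\Pi(\mu_1,\dots,\mu_N)$ is the set of Borel probability measures on $\mathbb R^{Nd}=(\mathbb R^d)^N$ with $i$-th marginal $\mu_i$ for every $i$. $\overline x_p(x_1,\dots,x_N)$ is the unique minimizer over $z\in\mathbb R^d$ of $\sum_{i=1}^N\lambda_i|x_i-z|^p$, and $c_p(x_1,\dots,x_N):=\min_{z\in\mathbb R^d}\sum_{i=1}^N\lambda_i|x_i-z|^p$. $W_p(\mu,\rho)=\min_{\eta\in\Pi(\mu,\rho)}\left(\int|x-y|^p\,\mathrm d\eta(x,y)\right)^{1/p}$. The symbol $\sharp$ denotes push-forward. *)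

(* Defs.v *)
From HB Require Import structures.
From mathcomp Require Import all_boot all_order all_algebra.
From mathcomp Require Import all_classical all_reals all_analysis.
Set Implicit Arguments.
Unset Strict Implicit.
Unset Printing Implicit Defensive.
Import Order.TTheory GRing.Theory Num.Theory.
Import numFieldNormedType.Exports.
Local Open Scope classical_set_scope.
Local Open Scope ring_scope.

Definition minimizers disp (T : Type) (V : porderType disp) (A : set T)
    (f : T -> V) : set T :=
  [set a | A a /\ forall b, A b -> (f a <= f b)%O].

(* The minimal value is unique by antisymmetry; [v0] is the junk value returned
   when the minimum is not attained. *)
Definition minimum disp (T : Type) (V : porderType disp) (v0 : V) (A : set T)
    (f : T -> V) : V :=
  xget v0 (f @` minimizers A f).

(* R^(md) = (R^d)^m with its Borel sigma-algebra; a point (x_1, ..., x_m) is the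
   m x d matrix whose i-th row is x_i. *)
Definition borel_mx (R : realType) (m d : nat) :
    measurableType (sigma_display (@open 'M[R]_(m, d))) :=
  g_sigma_algebraType (@open 'M[R]_(m, d)).

Definition borel_rV (R : realType) (d : nat) := borel_mx R 1 d.

(* The library norm on matrices is the sup norm. *)
Definition enorm (R : realType) (d : nat) (x : 'rV[R]_d) : R :=
  Num.sqrt (\sum_(j < d) x 0 j ^+ 2).

Definition finite_moment (R : realType) (d : nat) (p : R) :
    set (probability (borel_rV R d) R) :=
  [set mu | (\int[mu]_(x in [set: borel_rV R d])
               (enorm (x : 'rV[R]_d) `^ p)%:E < +oo)%E].

(* A library measure is a function on all sets, of which only the values on
   measurable sets are meaningful: hence no Leibniz equality with [mu i]. *)
Definition couplings (R : realType) (N d : nat)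
    (mu : 'I_N -> probability (borel_rV R d) R) :
    set (probability (borel_mx R N d) R) :=
  [set gamma | forall (i : 'I_N) (A : set (borel_rV R d)), measurable A ->
     pushforward gamma (row i : borel_mx R N d -> borel_rV R d) A = mu i A].

Definition wasserstein (R : realType) (d : nat) (p : R)
    (mu rho : probability (borel_rV R d) R) : \bar R :=
  ((minimum +oo (couplings (tnth [tuple mu; rho]))
      (fun eta => \int[eta]_(x in [set: borel_mx R 2 d])
         (enorm (row 0 (x : 'M[R]_(2, d)) - row 1 (x : 'M[R]_(2, d))) `^ p)%:E))
   `^ p^-1)%E.

Section barycenter.
Context (R : realType) (N d : nat) (p : R) (lambda : 'I_N -> R).

Definition dispersion (x : 'M[R]_(N, d)) (z : 'rV[R]_d) : R :=
  \sum_(i < N) lambda i * enorm (row i x - z) `^ p.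

Definition barycenter (x : borel_mx R N d) : borel_rV R d :=
  xget (0 : 'rV[R]_d) (minimizers setT (dispersion x)).

Definition barycenter_cost (x : borel_mx R N d) : R :=
  minimum 0 setT (dispersion x).

Definition multimarginal_cost (gamma : probability (borel_mx R N d) R) :
    \bar R :=
  (\int[gamma]_(x in [set: borel_mx R N d]) (barycenter_cost x)%:E)%E.

Definition barycenter_functional (mu : 'I_N -> probability (borel_rV R d) R)
    (nu : probability (borel_rV R d) R) : \bar R :=
  (\sum_(i < N) (lambda i)%:E * wasserstein p (mu i) nu `^ p)%E.

End barycenter.

(* Main.v *)
Require Import Defs.
From HB Require Import structures.
From mathcomp Require Import all_boot all_order all_algebra.
From mathcomp Require Import all_classical all_reals all_analysis.
From mathcomp Require Import measurable_realfun ring lra.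
Set Implicit Arguments.
Unset Strict Implicit.
Unset Printing Implicit Defensive.
Import Order.TTheory GRing.Theory Num.Theory.
Import numFieldNormedType.Exports.
Local Open Scope classical_set_scope.
Local Open Scope ring_scope.

(** Pushing [gamma] forward by [x |-> barycenter x] produces a measure [nu] coupled
    to every [mu_i], so [F nu] is at most the integral of [c_p] against [gamma].
    Conversely, gluing optimal plans of the pairs [(mu_i, nu)] along [nu] yields
    the joint law of some [(x, z)] with [z] of law [nu] and [x] of law [gamma] in
    [Pi(mu)]; as [c_p x] bounds the dispersion of [x] around [z] from below, the
    integral of [c_p] against [gamma] is at most [F nu], and equality of these
    finite quantities forces [z = barycenter x] almost surely.  Hence both minima
    coincide and the minimizers correspond.

    Existence of minimizers and gluing rest on one compactness principle, which
    replaces Prokhorov's theorem and disintegration.  For a tight sequence of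
    measures, the sets that are approximated from inside by closed and from outside
    by open sets uniformly along the sequence form an algebra; on it, the limits
    along an ultrafilter are countably additive, and their Caratheodory extension is
    a weak limit, against which integrals of nonnegative continuous functions are
    lower semicontinuous.  Measures with prescribed marginals are tight, and every
    rational box belongs to the algebra.  Gluing is the limit of couplings that
    glue correctly on the first [n] rational boxes only: these are mixtures of
    products over the finitely many pieces cut out by the boxes. *)

(** * Topology and Borel sets of matrix spaces *)

Lemma mx_continuous (R : realType) (m d : nat) (T : topologicalType)
    (f : T -> 'M[R]_(m, d)) :
  (forall i j, continuous (fun x => f x i j)) -> continuous f.
Proof.
move=> fc x A [P /= xP PA]; rewrite nbhs_filterE.
have Pf i j : \forall y \near x, P i j (f y i j) by exact: fc (xP i j).
have : \forall y \near x, forall i j, P i j (f y i j).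
  by apply: filter_forall => i; apply: filter_forall => j; exact: Pf.
by apply: filterS => y Py; exact: PA.
Qed.

Lemma row_continuous (R : realType) (m d : nat) (i : 'I_m) :
  continuous (row i : 'M[R]_(m, d) -> 'rV[R]_d).
Proof.
apply: mx_continuous => j k x.
rewrite (_ : (fun x => _) = (fun x : 'M[R]_(m, d) => x i k)).
  exact: coord_continuous.
by apply/funext => y; rewrite mxE.
Qed.

Section rational_boxes.
Context (R : realType) (m d : nat).

(** Rational bounds leave only countably many boxes. They are stable under intersection and form a
    base of the topology, so a finite Borel measure is determined by its values on them. *)
Definition rbox (ab : 'M[rat]_(m, d) * 'M[rat]_(m, d)) : set 'M[R]_(m, d) :=
  [set x | forall i j, ratr (ab.1 i j) < x i j < ratr (ab.2 i j)].

Lemma rboxI (ab cd : 'M[rat]_(m, d) * 'M[rat]_(m, d)) :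
  rbox ab `&` rbox cd =
  rbox (\matrix_(i, j) Num.max (ab.1 i j) (cd.1 i j),
        \matrix_(i, j) Num.min (ab.2 i j) (cd.2 i j)).
Proof.
have rmax (x y : rat) : ratr (Num.max x y) = Num.max (ratr x) (ratr y) :> R.
  by rewrite /Order.max ltr_rat; case: ifP.
have rmin (x y : rat) : ratr (Num.min x y) = Num.min (ratr x) (ratr y) :> R.
  by rewrite /Order.min ltr_rat; case: ifP.
apply/seteqP; split=> [x [xab xcd] i j|x xabcd].
  rewrite !mxE /= rmax rmin gt_max lt_min.
  by have /andP[-> ->] := xab i j; have /andP[-> ->] := xcd i j.
split=> i j; have := xabcd i j; rewrite !mxE /= rmax rmin gt_max lt_min.
  by move=> /andP[/andP[-> _] /andP[-> _]].
by move=> /andP[/andP[_ ->] /andP[_ ->]].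
Qed.

Lemma open_rbox ab : open (rbox ab).
Proof.
rewrite openE => x xab.
exists (fun i j => [set y | ratr (ab.1 i j) < y] `&`
                    [set y | y < ratr (ab.2 i j)]) => [i j|y yab i j].
  apply: open_nbhs_nbhs; split; first by apply: openI; [exact: open_gt|exact: open_lt].
  by have /andP[] := xab i j.
by have [ya yb] := yab i j; apply/andP.
Qed.

Lemma open_bigcup_rbox (A : set 'M[R]_(m, d)) : open A ->
  A = \bigcup_(ab in [set ab | rbox ab `<=` A]) rbox ab.
Proof.
move=> oA; apply/seteqP; split=> [x Ax|x [ab /= abA /abA]//].
have [P /= xP PA] : nbhs x A by exact: open_nbhs_nbhs.
(* A basic neighbourhood of [x] is a product of neighbourhoods of its entries, so rational endpoints
   can be chosen one entry at a time. *)
have /choice[h hP] (ij : 'I_m * 'I_d) : exists q : rat * rat,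
    ratr q.1 < x ij.1 ij.2 < ratr q.2 /\
    forall y : R, ratr q.1 < y < ratr q.2 -> P ij.1 ij.2 y.
  have /nbhs_ballP[e /= e0 eP] := xP ij.1 ij.2.
  have [a aI] : exists q : rat, ratr q \in `]x ij.1 ij.2 - e, x ij.1 ij.2[.
    by apply: rat_in_itvoo; rewrite ltrBlDr ltrDl.
  have [b bI] : exists q : rat, ratr q \in `]x ij.1 ij.2, x ij.1 ij.2 + e[.
    by apply: rat_in_itvoo; rewrite ltrDl.
  exists (a, b); move: aI bI; rewrite !in_itv /= => /andP[a1 a2] /andP[b1 b2].
  split; first by rewrite a2 b1.
  move=> y /andP[ay yb]; apply: eP; rewrite /ball /= ltr_distl.
  by apply/andP; split; lra.
exists (\matrix_(i, j) (h (i, j)).1, \matrix_(i, j) (h (i, j)).2) => /=.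
  move=> y yh; apply: PA => i j; apply: (hP (i, j)).2.
  by have := yh i j; rewrite !mxE.
by move=> i j; rewrite !mxE; exact: (hP (i, j)).1.
Qed.

Lemma measurable_open_mx (A : set 'M[R]_(m, d)) :
  open A -> measurable (A : set (borel_mx R m d)).
Proof. exact: sub_sigma_algebra. Qed.

Lemma measurable_closed_mx (A : set 'M[R]_(m, d)) :
  closed A -> measurable (A : set (borel_mx R m d)).
Proof.
move=> cA; rewrite -(setCK A); apply: measurableC.
by apply: measurable_open_mx; exact: closed_openC.
Qed.

Lemma measurable_rbox ab : measurable (rbox ab : set (borel_mx R m d)).
Proof. by apply: measurable_open_mx; exact: open_rbox. Qed.

(** Open sets are countable unions of boxes, and the preimage of a box is a finite intersection of
    preimages of intervals under the entries. *)
Lemma measurable_to_mx d' (T : measurableType d') (f : T -> borel_mx R m d) :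
  (forall i j, measurable_fun setT (fun x => (f x : 'M[R]_(m, d)) i j)) ->
  measurable_fun setT f.
Proof.
move=> mf.
refine (@measurability _ _ T (borel_mx R m d) setT f (@open 'M[R]_(m, d)) erefl _).
move=> _ [A oA <-]; rewrite setTI (open_bigcup_rbox oA) preimage_bigcup.
rewrite bigcup_mkcond; apply: countable_bigcupT_measurable => [|ab].
  exact: countableP.
case: ifPn => // _.
rewrite (_ : _ @^-1` _ = \bigcap_(ij in [set: 'I_m * 'I_d])
   ((fun x => (f x : 'M[R]_(m, d)) ij.1 ij.2) @^-1`
     `]ratr (ab.1 ij.1 ij.2), ratr (ab.2 ij.1 ij.2)[)).
  apply: fin_bigcap_measurable; first exact: finite_finset.
  by move=> ij _; rewrite -[X in measurable X]setTI; exact: mf.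
apply/seteqP; split=> [x fx [i j] _|x fx i j] /=.
  by rewrite in_itv /=; exact: fx.
by have /= := fx (i, j) Logic.I; rewrite in_itv.
Qed.

Lemma continuous_measurable_mx (f : 'M[R]_(m, d) -> R) : continuous f ->
  measurable_fun setT (f : borel_mx R m d -> R).
Proof.
move=> fc; apply: (measurability _ (measurable_realfun.RGenOInfty.measurableE R)).
move=> _ [_ [x ->] <-]; rewrite setTI; apply: measurable_open_mx.
apply: open_comp => [y _|]; first exact: fc.
rewrite (_ : [set` _] = [set y | x < y]); first exact: open_gt.
by apply/seteqP; split=> y /=; rewrite in_itv /= andbT.
Qed.

End rational_boxes.

Lemma continuous_measurable_mx2 (R : realType) (m d m' d' : nat)
    (f : 'M[R]_(m, d) -> 'M[R]_(m', d')) : continuous f ->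
  measurable_fun setT (f : borel_mx R m d -> borel_mx R m' d').
Proof.
move=> fc; refine (@measurability _ _ _ (borel_mx R m' d') setT _
  (@open 'M[R]_(m', d')) erefl _).
move=> _ [A oA <-]; rewrite setTI; apply: measurable_open_mx.
by apply: open_comp => // y _; exact: fc.
Qed.

Lemma measurable_row (R : realType) (m d : nat) (i : 'I_m) :
  measurable_fun setT (row i : borel_mx R m d -> borel_rV R d).
Proof. by apply: continuous_measurable_mx2; exact: row_continuous. Qed.

Lemma measurable_coord (R : realType) (m d : nat) (i : 'I_m) (j : 'I_d) :
  measurable_fun setT (fun x : borel_mx R m d => (x : 'M[R]_(m, d)) i j).
Proof. by apply: continuous_measurable_mx; exact: coord_continuous. Qed.

Lemma bigcup_rbox (R : realType) (m d : nat) :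
  \bigcup_k @rbox R m d (const_mx (- k%:R), const_mx k%:R) = setT.
Proof.
apply/seteqP; split=> // x _.
(* The sum of the absolute values of all entries bounds each of them; the successor of its
   truncation makes the bound strict. *)
exists (Num.trunc (\sum_i \sum_j `|x i j|)).+1 => // i j /=; rewrite !mxE.
rewrite rmorphN /= ratr_nat -ltr_norml.
apply: le_lt_trans (truncnS_gt _).
rewrite (bigD1 i) //= (bigD1 j) //= -addrA lerDl addr_ge0 ?sumr_ge0 //.
by move=> k _; rewrite sumr_ge0.
Qed.

(** Boxes generate the Borel sets and are closed under intersection, and the cubes with bounds [-k]
    and [k] exhaust the space with finite mass, so uniqueness of measures applies. *)
Lemma eq_measure_rbox (R : realType) (m d : nat)
    (m1 m2 : {measure set (borel_mx R m d) -> \bar R}) :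
  (m1 setT < +oo)%E -> (forall ab, m1 (rbox ab) = m2 (rbox ab)) ->
  forall A, measurable A -> m1 A = m2 A.
Proof.
move=> m1T m12 A mA.
have rboxE : measurable = <<s range (@rbox R m d) >> :> set (set (borel_mx R m d)).
  apply/seteqP; split=> [B|]; last first.
    apply: smallest_sub; first exact: sigma_algebra_measurable.
    by move=> _ [ab _ <-]; exact: measurable_rbox.
  move: B; apply: smallest_sub; first exact: smallest_sigma_algebra.
  move=> B oB; rewrite (open_bigcup_rbox oB) bigcup_mkcond.
  apply: (@countable_bigcupT_measurable _ (g_sigma_algebraType (range (@rbox R m d)))) => [|ab].
    exact: countableP.
  case: ifPn => // _; first by apply: sub_sigma_algebra; exists ab.
refine (@measure_unique _ R (borel_mx R m d) (range (@rbox R m d))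
  (fun k => rbox (const_mx (- k%:R), const_mx k%:R)) rboxE _ _ _ m1 m2 _ _ _ mA).
- by move=> _ _ [ab _ <-] [cd _ <-]; rewrite rboxI; eexists.
- by move=> k; eexists.
- by rewrite bigcup_rbox.
- by move=> _ [ab _ <-].
- move=> k; apply: le_lt_trans m1T; apply: le_measure => //; rewrite inE //.
  exact: measurable_rbox.
Qed.

(** Reshaping matrices into row vectors turns the cube into a product of segments. *)
Lemma compact_cbox (R : realType) (m d : nat) (M : R) :
  compact [set x : 'M[R]_(m, d) | forall i j, `|x i j| <= M].
Proof.
have -> : [set x : 'M[R]_(m, d) | forall i j, `|x i j| <= M] =
    vec_mx @` [set v : 'rV[R]_(m * d) | forall k, `[- M, M]%classic (v ord0 k)].
  apply/seteqP; split=> [x xM|_ [v vM <-] i j] /=.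
    exists (mxvec x); last by rewrite mxvecK.
    move=> k; case/mxvec_indexP: k => i j.
    by rewrite mxvecE /= in_itv /= -ler_norml.
  by rewrite mxE ler_norml; have /= := vM (mxvec_index i j); rewrite in_itv.
apply: continuous_compact.
  apply: continuous_subspaceT; apply: mx_continuous => i j.
  rewrite (_ : (fun x => _) = (fun x : 'rV[R]_(m * d) => x 0 (mxvec_index i j))).
    exact: coord_continuous.
  by apply/funext => x; rewrite mxE.
by apply: (@rV_compact R _ (fun=> `[- M, M]%classic)) => k; exact: segment_compact.
Qed.

(** * Limits of measures along an ultrafilter *)

(** The sum counts the steps of height [h] strictly below [t]. With [t] replaced by a continuous
    function it becomes a combination of indicators of open superlevel sets. *)
Lemma staircase_le (R : realType) (h t : R) n : 0 <= h -> 0 <= t ->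
  \sum_(j < n) h * (j.+1%:R * h < t)%R%:R <= Num.min t (n%:R * h).
Proof.
move=> h0 t0; rewrite le_min; elim: n => [|n /andP[IH1 IH2]].
  by rewrite big_ord0 mul0r lexx t0.
rewrite big_ord_recr /=; case: ltP => nt; rewrite ?mulr1 ?mulr0 ?addr0.
  have nh : n.+1%:R * h = n%:R * h + h by rewrite -natr1 mulrDl mul1r.
  by rewrite nh lerD2r IH2 andbT (le_trans _ (ltW nt)) // nh lerD2r.
by rewrite IH1 (le_trans IH2) // ler_wpM2r // ler_nat.
Qed.

(** The staircase misses [t] by at most [h] until it is capped by its number of steps. *)
Lemma staircase_ge (R : realType) (h t : R) n : 0 <= h ->
  Num.min (t - h) (n%:R * h) <= \sum_(j < n) h * (j.+1%:R * h < t)%R%:R.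
Proof.
move=> h0; elim: n => [|n IH]; first by rewrite big_ord0 mul0r ge_min lexx orbT.
have nh : n.+1%:R * h = n%:R * h + h by rewrite -natr1 mulrDl mul1r.
rewrite big_ord_recr /=; case: ltP => nt; rewrite ?mulr1 ?mulr0 ?addr0.
  rewrite ge_min nh lerD2r; apply/orP; right; move: IH; rewrite (min_idPr _) //.
  by rewrite lerBrDr -nh ltW.
move: IH; rewrite ge_min => /orP[|IH]; first by rewrite ge_min => ->.
rewrite ge_min; apply/orP; left; apply: le_trans IH.
by rewrite lerBlDr -nh.
Qed.

(** The finite unions grow with [r], so near each point of [K] all large [r] work; compactness makes
    one [r] work on all of [K]. *)
Lemma compact_nat_cover (T : topologicalType) (K : set T) (G : (set T)^nat) :
  compact K -> (forall k, open (G k)) -> K `<=` \bigcup_k G k ->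
  exists r, K `<=` \big[setU/set0]_(k < r) G k.
Proof.
move=> cK oG KG.
have /compact_near_coveringP cov := cK.
have [|r _ rK] := cov _ \oo (fun r x => (\big[setU/set0]_(k < r) G k) x) _.
  move=> x Kx; have [k _ Gx] := KG _ Kx.
  exists (G k, [set r | (k < r)%N]); first split => /=.
  - exact: open_nbhs_nbhs.
  - by exists k.+1.
  - by move=> [y r] /= [Gy kr]; rewrite -bigcup_mkord; exists k.
by exists r; exact: (rK r (leqnn _)).
Qed.

Lemma sum_geometric_half (R : realType) (c : R) n :
  \sum_(k < n) c / 2 ^+ k.+1 = c - c / 2 ^+ n.
Proof.
elim: n => [|n IHn]; first by rewrite big_ord0 expr0 divr1 subrr.
rewrite big_ord_recr /= IHn exprS invfM mulrA.
have -> : c / 2 ^+ n = 2 * (c / 2 / 2 ^+ n).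
  by rewrite [c / 2]mulrC -!mulrA mulrA divff ?mul1r // pnatr_eq0.
lra.
Qed.

Lemma measure_vanish d (T : measurableType d) (R : realType)
    (P : probability T R) (F : (set T)^nat) (e : R) :
  (forall k, measurable (F k)) -> nonincreasing_seq F ->
  \bigcap_k F k = set0 -> 0 < e -> exists k, (P (F k) <= e%:E)%E.
Proof.
move=> mF ndF F0 e0.
have : P (F n) @[n --> \oo] --> (0 : \bar R).
  rewrite -(measure0 P) -F0; apply: nonincreasing_cvg_mu => //.
  - by rewrite (le_lt_trans (probability_le1 P (mF 0%N))) ?ltry.
  - exact: bigcapT_measurable.
move=> /fine_cvgP[_ /cvgr_le /(_ e e0)] [k _ /(_ k (leqnn _)) ke].
by exists k; rewrite -(fineK (fin_num_measure P _ (mF k))) lee_fin.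
Qed.

(** * The algebra of uniformly regular sets *)

Section uniformly_regular.
Context (R : realType) (m d : nat) (gam : nat -> probability (borel_mx R m d) R).

(** [K] and [G] depend on [e] but not on [n]. Thanks to this uniformity one finite cover serves all
    the measures at once, which keeps their limit countably additive. *)
Definition uregular (A : set (borel_mx R m d)) : Prop :=
  measurable A /\ forall e : R, 0 < e ->
  exists K G : set 'M[R]_(m, d), [/\ closed K, open G, K `<=` A, A `<=` G
    & forall n, (gam n (G `\` K : set (borel_mx R m d)) <= e%:E)%E].

Lemma uregular0 : uregular set0.
Proof.
split=> // e e0; exists set0, set0; split=> //; first exact: closed0.
by move=> n; rewrite setD0 measure0 lee_fin ltW.
Qed.

Lemma uregularC A : uregular A -> uregular (~` A).
Proof.
move=> [mA rA]; split; first exact: measurableC.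
move=> e /rA[K [G [cK oG KA AG GK]]]; exists (~` G), (~` K); split.
- exact: open_closedC.
- exact: closed_openC.
- exact: subsetC.
- exact: subsetC.
- by move=> n; rewrite setDE setCK setIC -setDE.
Qed.

Lemma uregularU A B : uregular A -> uregular B -> uregular (A `|` B).
Proof.
move=> [mA rA] [mB rB]; split; first exact: measurableU.
move=> e e0; have e20 : 0 < e / 2 by rewrite divr_gt0.
have [K [G [cK oG KA AG GK]]] := rA _ e20.
have [L [H [cL oH LB BH HL]]] := rB _ e20.
exists (K `|` L), (G `|` H); split.
- exact: closedU.
- exact: openU.
- exact: setUSS.
- exact: setUSS.
move=> n.
have mGK : measurable (G `\` K : set (borel_mx R m d)).
  by apply: measurableD; [exact: measurable_open_mx|exact: measurable_closed_mx].
have mHL : measurable (H `\` L : set (borel_mx R m d)).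
  by apply: measurableD; [exact: measurable_open_mx|exact: measurable_closed_mx].
apply: (@le_trans _ _ (gam n ((G `\` K) `|` (H `\` L)))).
  apply: le_measure; rewrite ?inE.
  - apply: measurableD; apply: measurableU; by
      [exact: measurable_open_mx|exact: measurable_closed_mx].
  - exact: measurableU.
  - by move=> x [[Gx|Hx] /not_orP[nK nL]]; [left|right].
apply: le_trans (measureU2 _ mGK mHL) _.
rewrite [e]splitr EFinD; apply: leeD; [exact: GK|exact: HL].
Qed.

Lemma uregularI A B : uregular A -> uregular B -> uregular (A `&` B).
Proof.
move=> rA rB; rewrite -(setCK A) -(setCK B) -setCU.
by apply: uregularC; apply: uregularU; exact: uregularC.
Qed.

(* The unused argument lets the algebra-of-sets instance depend on the measures. *)
Definition uregular_algebra (_ : nat -> probability (borel_mx R m d) R) : Type :=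
  'M[R]_(m, d).

HB.instance Definition _ := Pointed.on (uregular_algebra gam).
HB.instance Definition _ := @isAlgebraOfSets.Build default_measure_display
  (uregular_algebra gam) uregular uregular0 uregularU uregularC.

End uniformly_regular.

(** * The weak limit along an ultrafilter *)

Section ultralimit.
Context (R : realType) (m d : nat) (gam : nat -> probability (borel_mx R m d) R).
Context (U : set_system nat) {UU : UltraFilter U}.

Definition ulim (A : set (borel_mx R m d)) : R :=
  lim (fine (gam n A) @[n --> U]).

(** The values stay in the compact segment from 0 to 1, hence have a cluster point. For each
    neighbourhood of it, either its preimage or the complement of that preimage is in [U], and the
    latter contradicts clustering. *)
Lemma ulim_cvg A : measurable A -> fine (gam n A) @[n --> U] --> ulim A.
Proof.
move=> mA; have UA : U ((fun n => fine (gam n A)) @^-1` `[0, 1]%classic).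
  apply: filterE => n; rewrite /= in_itv /= fine_ge0 ?measure_ge0 //=.
  by rewrite -lee_fin fineK ?fin_num_measure ?probability_le1.
have [x [_ xU]] := @segment_compact R 0 1
  (fmap (fun n => fine (gam n A)) U) _ UA.
suff: fine (gam n A) @[n --> U] --> x by move=> /cvgP.
move=> V xV; have [//|UnV] := in_ultra_setVsetC ((fun n => fine (gam n A)) @^-1` V) UU.
by have [y []] := xU (~` V) V UnV xV.
Qed.

Lemma ulim_ge0 A : measurable A -> 0 <= ulim A.
Proof.
move=> mA; apply: limr_ge; first by apply/cvg_ex; exists (ulim A); exact: ulim_cvg.
by apply: filterE => n; exact: fine_ge0.
Qed.

Lemma le_ulim A B : measurable A -> measurable B -> A `<=` B -> ulim A <= ulim B.
Proof.
move=> mA mB AB; apply: ler_cvg_to (ulim_cvg mA) (ulim_cvg mB) _.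
apply: filterE => n; rewrite fine_le ?fin_num_measure //.
by apply: le_measure; rewrite ?inE.
Qed.

Lemma ulimU A B : measurable A -> measurable B -> A `&` B = set0 ->
  ulim (A `|` B) = ulim A + ulim B.
Proof.
move=> mA mB AB; apply: cvg_lim => //.
rewrite (_ : (fun n => _) = (fun n => fine (gam n A) + fine (gam n B))).
  exact: cvgD (ulim_cvg mA) (ulim_cvg mB).
by apply/funext => n; rewrite measureU // fineD ?fin_num_measure.
Qed.

Lemma ulim_const A (c : R) : measurable A ->
  (\forall n \near U, fine (gam n A) = c) -> ulim A = c.
Proof.
move=> mA Ac; apply: cvg_lim => //; apply: cvg_near_cst.
by apply: filterS Ac => n ->.
Qed.

(* A content must be nonnegative on every set, but [ulim] is a junk limit off the
   measurable ones. *)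
Definition ucontent (A : set (uregular_algebra gam)) : \bar R := (Num.max 0 (ulim A))%:E.

Let ucontent_ge0 A : (0 <= ucontent A)%E.
Proof. by rewrite lee_fin le_max lexx. Qed.

Let ucontentE A : measurable A -> ucontent A = (ulim A)%:E.
Proof. by move=> [mA _]; rewrite /ucontent (max_idPr _) // ulim_ge0. Qed.

Let ucontent_additive : measure_function.semi_additive ucontent.
Proof.
apply/additive2P.
  rewrite ucontentE //; congr EFin; apply: ulim_const => //.
  by apply: filterE => n; rewrite measure0.
move=> A B mA mB AB; rewrite !ucontentE //; last exact: measurableU.
by rewrite (ulimU mA.1 mB.1 AB).
Qed.

HB.instance Definition _ := isContent.Build default_measure_display
  (uregular_algebra gam) R ucontent ucontent_ge0 ucontent_additive.

Hypothesis tight : forall e : R, 0 < e -> exists C : set 'M[R]_(m, d),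
  [/\ compact C, closed C
    & forall n, (gam n (~` C : set (borel_mx R m d)) <= e%:E)%E].

(** Up to small mass, [A] lies in the compact intersection of [K] and [C], which finitely many open
    enlargements [H k] of the [F k] cover. The mass of [G] outside [K], the mass outside [C] and the
    enlargements cost [e / 3] each. Since [K], [C] and [H] do not depend on [n], neither does
    [r]. *)
Let cover_le (A : set (borel_mx R m d)) (F : (set (borel_mx R m d))^nat) (e : R) :
  0 < e -> uregular gam A -> (forall k, uregular gam (F k)) ->
  A `<=` \bigcup_k F k ->
  exists r, forall n, (gam n A <= e%:E + \sum_(k < r) gam n (F k))%E.
Proof.
move=> e0 [mA rA] rF AF; have e30 : 0 < e / 3 by rewrite divr_gt0.
have [K [G [cK oG KA AG GK]]] := rA _ e30.
have [C [kC cC gC]] := tight e30.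
have /choice[H HP] (k : nat) : exists H : set 'M[R]_(m, d),
    [/\ open H, F k `<=` H
      & forall n, (gam n (H `\` F k : set (borel_mx R m d)) <= (e / 3 / 2 ^+ k.+1)%:E)%E].
  have [mF /(_ (e / 3 / 2 ^+ k.+1))[|L [H [cL oH LF FH HL]]]] := rF k.
    by rewrite divr_gt0 // exprn_gt0.
  exists H; split=> // n; apply: le_trans (HL n).
  apply: le_measure; rewrite ?inE.
  - by apply: measurableD => //; exact: measurable_open_mx.
  - by apply: measurableD; [exact: measurable_open_mx|exact: measurable_closed_mx].
  - exact: setDS.
have [r rP] : exists r, K `&` C `<=` \big[setU/set0]_(k < r) H k.
  apply: compact_nat_cover.
  - by rewrite setIC; exact: compact_closedI.
  - by move=> k; have [] := HP k.
  - move=> x [/KA/AF[k _ Fx] _]; exists k => //.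
    by have [_ FH _] := HP k; exact: FH.
exists r => n.
have mH k : measurable (H k : set (borel_mx R m d)).
  by apply: measurable_open_mx; have [] := HP k.
have mK := measurable_closed_mx cK; have mC := measurable_closed_mx cC.
have mG := measurable_open_mx oG.
have mHr : measurable (\big[setU/set0]_(k < r) H k : set (borel_mx R m d)).
  by apply: bigsetU_measurable.
have mGK : measurable (G `\` K : set (borel_mx R m d)) by exact: measurableD.
have mC' : measurable (~` C : set (borel_mx R m d)) by exact: measurableC.
apply: (@le_trans _ _ (gam n ((G `\` K) `|` ((~` C) `|`
    \big[setU/set0]_(k < r) H k)))).
  apply: le_measure; rewrite ?inE //.
    by apply: measurableU => //; exact: measurableU.
  move=> x Ax; have [Kx|nKx] := pselect (K x); last by left; split=> //; exact: AG.
  by right; have [Cx|] := pselect (C x); [right; exact: rP|left].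
apply: le_trans (measureU2 _ mGK (measurableU _ _ mC' mHr)) _.
apply: (@le_trans _ _ ((e / 3)%:E + ((e / 3)%:E +
    \sum_(k < r) gam n (H k)))%E).
  apply: leeD; first exact: GK.
  apply: le_trans (measureU2 _ mC' mHr) _.
  apply: leeD; first exact: gC.
  by apply: Boole_inequality => k _; exact: mH.
apply: (@le_trans _ _ ((e / 3)%:E + ((e / 3)%:E + ((e / 3)%:E +
    \sum_(k < r) gam n (F k))))%E); last first.
  by rewrite !addeA -!EFinD (_ : e / 3 + e / 3 + e / 3 = e) //; field.
do 2 apply: leeD => //.
apply: (@le_trans _ _ (\sum_(k < r) ((e / 3 / 2 ^+ k.+1)%:E + gam n (F k)))%E).
  apply: lee_sum => k _; have [oH FH HF] := HP k.
  have mF := (rF k).1.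
  rewrite (_ : H k = (H k `\` F k) `|` F k); last by rewrite setUC setDUK.
  apply: le_trans (measureU2 _ _ _) _ => //; first exact: measurableD.
  by apply: leeD => //; exact: HF.
rewrite big_split /=; apply: leeD => //.
rewrite sumEFin lee_fin sum_geometric_half gerDl oppr_le0.
by rewrite divr_ge0 ?exprn_ge0 // ltW.
Qed.

(** The number of sets kept by [cover_le] is the same for all [n], so the finite inequality passes
    to the limit along [U]; the series then dominates its partial sum. *)
Let ucontent_subadditive : measurable_subset_sigma_subadditive ucontent.
Proof.
move=> A F mF mA AF; apply/lee_addgt0Pr => e e0; rewrite addeC.
have [r rP] := cover_le e0 mA mF AF.
apply: (@le_trans _ _ (e%:E + \sum_(k < r) ucontent (F k))%E); last first.
  apply: leeD => //; rewrite -(big_mkord xpredT (fun k => ucontent (F k))).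
  by apply: nneseries_lim_ge => k _ _; exact: ucontent_ge0.
rewrite ucontentE // (eq_bigr (fun k : 'I_r => (ulim (F k))%:E)); last first.
  by move=> k _; rewrite ucontentE.
rewrite sumEFin -EFinD lee_fin.
have mF' k : measurable (F k : set (borel_mx R m d)) by have [] := mF k.
have : e + \sum_(k < r) fine (gam n (F k)) @[n --> U] --> e + \sum_(k < r) ulim (F k).
  apply: cvgD; first exact: cvg_cst.
  apply: cvg_big => [|k _]; [exact: add_continuous|exact: ulim_cvg].
move/(ler_cvg_to (ulim_cvg mA.1)); apply; apply: filterE => n.
rewrite -lee_fin fineK ?fin_num_measure //; last exact: mA.1.
rewrite EFinD -sumEFin (eq_bigr (fun k : 'I_r => gam n (F k))) //.
by move=> k _; rewrite fineK // fin_num_measure.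
Qed.

Hypothesis uregular_rbox : forall ab, uregular gam (@rbox R m d ab).

(** The Caratheodory extension of the content lives on the sigma-algebra generated by the uniformly
    regular sets. This contains the Borel sets, because open sets are countable unions of boxes; the
    extension is restricted to them. *)
Lemma ulim_measure : exists g : probability (borel_mx R m d) R,
  forall A, uregular gam A -> g A = (ulim A)%:E.
Proof.
pose mu : {measure set (uregular_algebra gam) -> \bar R} := HB.pack ucontent
  (Content_SigmaSubAdditive_isMeasure.Build _ _ _ ucontent ucontent_subadditive).
pose g0 : set (borel_mx R m d) -> \bar R := measure_extension mu.
have muE A : uregular gam A -> g0 A = (ulim A)%:E.
  by move=> rA; rewrite -ucontentE //; exact: (@measurable_mu_extE _ _ _ mu A).
have sub (A : set (borel_mx R m d)) : measurable A ->
    measurable (A : set (g_sigma_algebraType (@measurable _ (uregular_algebra gam)))).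
  move: A; apply: smallest_sub; first exact: sigma_algebra_measurable.
  move=> A oA; rewrite (open_bigcup_rbox oA) bigcup_mkcond.
  apply: countable_bigcupT_measurable => [|ab]; first exact: countableP.
  case: ifPn => // _; apply: sub_sigma_algebra; exact: uregular_rbox.
have g00 : g0 set0 = 0%E by exact: measure0.
have g0_ge0 A : (0 <= g0 A)%E by exact: measure_ge0.
have g0_add : semi_sigma_additive g0.
  move=> F mF tF mUF; apply: (@measure_semi_sigma_additive _ _ _
    (measure_extension mu)) => //; last exact: sub.
  by move=> k; exact: sub.
have g0T : g0 setT = 1%E.
  have rT : uregular gam setT by rewrite -setC0; apply: uregularC; exact: uregular0.
  rewrite muE //; congr EFin; apply: ulim_const => //.
  by apply: filterE => n; rewrite probability_setT.
pose mg := isMeasure.Build _ _ _ g0 g00 g0_ge0 g0_add.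
pose g1 : {measure set (borel_mx R m d) -> \bar R} := HB.pack g0 mg.
pose g : probability (borel_mx R m d) R := HB.pack g0 mg
  (Measure_isProbability.Build _ _ _ g1 g0T).
by exists g.
Qed.

Lemma uregular_bigU (F : (set (borel_mx R m d))^nat) n :
  (forall k, uregular gam (F k)) -> uregular gam (\big[setU/set0]_(k < n) F k).
Proof.
move=> rF; elim/big_ind : _ => // [|A B]; first exact: uregular0.
exact: uregularU.
Qed.

(** [G] is an increasing union of finite unions of boxes, where [g] and [ulim] agree. The measure
    [g] is continuous along this union while for [ulim] only monotonicity is used, whence an
    inequality. *)
Lemma ulim_open (g : probability (borel_mx R m d) R) (G : set (borel_mx R m d)) :
  (forall A, uregular gam A -> g A = (ulim A)%:E) ->
  @open 'M[R]_(m, d) G -> (g G <= (ulim G)%:E)%E.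
Proof.
move=> gE oG.
(* Codes of no box, or of a box not inside [G], contribute the empty set; this makes the union of
   boxes a sequence. *)
pose F k : set (borel_mx R m d) :=
  if unpickle k is Some ab then if `[< rbox ab `<=` G >] then rbox ab else set0
  else set0.
have rF k : uregular gam (F k).
  rewrite /F; case: unpickle => [ab|]; last exact: uregular0.
  by case: ifP => _; [exact: uregular_rbox|exact: uregular0].
have GF : G = \bigcup_k F k.
  apply/seteqP; split=> [x|x [k _]]; last first.
    by rewrite /F; case: unpickle => // ab; case: ifPn => // /asboolP; apply.
  rewrite {1}(open_bigcup_rbox oG) => -[ab /= abG abx].
  by exists (pickle ab) => //; rewrite /F pickleK; case: ifPn => // /asboolP.
pose S n := \big[setU/set0]_(k < n) F k.
have rS n : uregular gam (S n) by exact: uregular_bigU.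
have ndS : nondecreasing_seq S.
  move=> i j ij; apply/subsetPset; rewrite /S -!bigcup_mkord => x [k /= ki Fx].
  by exists k => //=; exact: leq_trans ki ij.
have GS : G = \bigcup_n S n.
  rewrite GF; apply/seteqP; split=> [x [k _ Fx]|x [n _]].
    by exists k.+1 => //; rewrite /S -bigcup_mkord; exists k => /=.
  by rewrite /S -bigcup_mkord => -[k _ Fx]; exists k.
have mG : measurable G by exact: measurable_open_mx.
have gS : g (S n) @[n --> \oo] --> g G.
  by rewrite GS; apply: nondecreasing_cvg_mu => //; [move=> n; exact: (rS n).1|rewrite -GS].
rewrite -(cvg_lim _ gS) //; apply: lime_le; first by apply/cvg_ex; exists (g G).
apply: nearW => n; rewrite gE // lee_fin; apply: le_ulim => //; first exact: (rS n).1.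
by rewrite GS; exact: bigcup_sup.
Qed.

(** Staircases under [c] are combinations of indicators of open superlevel sets, so [ulim_open]
    bounds their [g]-integrals by limits of [gam n]-integrals, hence by [L]. Fatou's lemma then
    passes from the staircases to [c]. *)
Lemma ulim_fatou (g : probability (borel_mx R m d) R) (c : 'M[R]_(m, d) -> R)
    (L : \bar R) :
  (forall A, uregular gam A -> g A = (ulim A)%:E) ->
  continuous c -> (forall x, 0 <= c x) ->
  (\forall n \near U, \int[gam n]_(x in [set: borel_mx R m d]) (c x)%:E <= L)%E ->
  (\int[g]_(x in [set: borel_mx R m d]) (c x)%:E <= L)%E.
Proof.
move=> gE cc c0 cL; case: L cL => [L||] cL; first last.
- have [n /=] := filter_ex cL; rewrite leeNy_eq => /eqP I0.
  suff : (0 <= -oo :> \bar R)%E by [].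
  by rewrite -I0; apply: integral_ge0 => x _; rewrite lee_fin.
- by rewrite leey.
(* The [N k] steps of height [h k] reach up to [k.+1]: as [k] grows the staircase becomes both finer
   and higher, hence converges to [c] pointwise. *)
pose h k : R := k.+1%:R^-1; pose N k := (k.+1 ^ 2)%N.
pose G k j : set (borel_mx R m d) := [set x | j.+1%:R * h k < c x].
pose s k (x : borel_mx R m d) := \sum_(j < N k) h k * \1_(G k j) x.
have h0 k : 0 < h k by rewrite invr_gt0.
have Nh k : (N k)%:R * h k = k.+1%:R.
  by rewrite /N /h natrX expr2 -mulrA divff ?mulr1 // pnatr_eq0.
have oG k j : @open 'M[R]_(m, d) (G k j).
  rewrite (_ : G k j = c @^-1` [set y | j.+1%:R * h k < y]) //.
  by apply: open_comp => [y _|]; [exact: cc|exact: open_gt].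
have mG k j : measurable (G k j) by exact: measurable_open_mx.
have sE k x : s k x = \sum_(j < N k) h k * (j.+1%:R * h k < c x)%R%:R.
  apply: eq_bigr => j _; rewrite indicE; congr (_ * (nat_of_bool _)%:R).
  by apply/idP/idP; rewrite inE.
have ms k : measurable_fun setT (s k).
  by apply: measurable_sum => j; apply: measurable_funM => //; exact: measurable_indic.
have s_le k x : s k x <= c x.
  by rewrite sE; have := staircase_le (N k) (ltW (h0 k)) (c0 x); rewrite le_min => /andP[].
have s_ge0 k x : 0 <= s k x.
  by apply: sumr_ge0 => j _; rewrite mulr_ge0 // ltW.
have int_s k (P : probability (borel_mx R m d) R) :
    (\int[P]_(x in [set: borel_mx R m d]) (s k x)%:E =
     \sum_(j < N k) (h k)%:E * P (G k j))%E.
  under eq_integral do rewrite /s -sumEFin.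
  rewrite ge0_integral_sum //; last 2 first.
  - by move=> j; apply/measurable_EFinP; apply: measurable_funM => //; exact: measurable_indic.
  - by move=> j x _; rewrite lee_fin mulr_ge0 // ltW.
  apply: eq_bigr => j _; under eq_integral do rewrite EFinM.
  rewrite ge0_integralZl_EFin ?ltW //; last first.
    by apply/measurable_EFinP; exact: measurable_indic.
  by rewrite integral_indic // setIT.
have int_s_le k :
    (\int[g]_(x in [set: borel_mx R m d]) (s k x)%:E <= L%:E)%E.
  rewrite int_s; apply: (@le_trans _ _ (\sum_(j < N k) (h k)%:E * (ulim (G k j))%:E)%E).
    apply: lee_sum => j _; apply: lee_pmul => //; first by rewrite lee_fin ltW.
    exact: ulim_open.
  rewrite (eq_bigr (fun j : 'I_(N k) => (h k * ulim (G k j))%:E)) //.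
  rewrite sumEFin lee_fin.
  have : \sum_(j < N k) h k * fine (gam n (G k j)) @[n --> U] -->
         \sum_(j < N k) h k * ulim (G k j).
    apply: cvg_big => [|j _]; first exact: add_continuous.
    by apply: cvgMr; exact: ulim_cvg.
  move/ler_cvg_to; apply; first exact: cvg_cst.
  apply: filterS cL => n; rewrite -lee_fin; apply: le_trans.
  apply: (@le_trans _ _ (\int[gam n]_(x in [set: borel_mx R m d]) (s k x)%:E)%E).
    rewrite int_s -sumEFin; apply: lee_sum => j _.
    by rewrite EFinM fineK // fin_num_measure.
  apply: ge0_le_integral => //.
  - by move=> x _; rewrite lee_fin.
  - exact/measurable_EFinP.
  - by apply/measurable_EFinP; exact: continuous_measurable_mx.
  - by move=> x _; rewrite lee_fin.
have s_cvg x : s k x @[k --> \oo] --> c x.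
  apply: (@squeeze_cvgr _ _ _ _ (fun k => c x - h k) (fun=> c x)).
  - near=> k; rewrite s_le andbT sE.
    apply: (le_trans _ (staircase_ge (c x) (N k) (ltW (h0 k)))).
    rewrite Nh le_min lexx /= lerBlDr (@le_trans _ _ k.+1%:R) //; last first.
      by rewrite lerDl ltW.
    apply: (@le_trans _ _ k%:R); last by rewrite ler_nat.
    by apply: ltW; near: k; exact: nbhs_infty_gtr.
  - rewrite -[X in _ --> X]subr0; apply: cvgB; first exact: cvg_cst.
    exact: cvg_harmonic.
  - exact: cvg_cst.
apply: (@le_trans _ _ (\int[g]_(x in [set: borel_mx R m d])
    limn_einf (fun k => (s k x)%:E))%E).
  rewrite le_eqVlt; apply/orP; left; apply/eqP; apply: eq_integral => x _.
  have /cvg_limn_einf_sup[-> _] // : (s k x)%:E @[k --> \oo] --> (c x)%:E.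
  by apply: cvg_EFin; [exact: nearW|exact: s_cvg].
apply: le_trans (fatou _ _ _ _) _ => //.
- by move=> k; exact/measurable_EFinP.
- by move=> k x _; rewrite lee_fin.
rewrite limn_einf_lim; apply: lime_le; first exact: is_cvg_einfs.
apply: nearW => k; apply: le_trans (int_s_le k).
by apply: ereal_inf_lbound; exists k => /=.
Unshelve. all: by end_near. Qed.

End ultralimit.

Lemma push_probability d d' (T : measurableType d) (T' : measurableType d')
    (R : realType) (P : probability T R) (f : T -> T') :
  measurable_fun setT f ->
  exists Q : probability T' R, forall A, Q A = P (f @^-1` A).
Proof.
move=> mf; pose f' : {mfun T >-> T'} := HB.pack f (isMeasurableFun.Build _ _ _ _ f mf).
by exists (distribution P f').
Qed.

Lemma measure_bigsetU_le d (T : measurableType d) (R : realType)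
    (P : probability T R) (I : Type) (s : seq I) (F : I -> set T) :
  (forall i, measurable (F i)) ->
  (P (\big[setU/set0]_(i <- s) F i) <= \sum_(i <- s) P (F i))%E.
Proof.
move=> mF; elim: s => [|i s IH]; first by rewrite !big_nil measure0.
rewrite !big_cons; apply: le_trans (measureU2 _ _ _) _ => //.
  exact: bigsetU_measurable.
exact: leeD.
Qed.

(** * Sequences of measures with fixed entry laws *)

Section constant_coordinate_laws.
Context (R : realType) (m d : nat) (gam : nat -> probability (borel_mx R m d) R).

(** The set is open, so it is its own [G]. Lowering the level by [k.+1%:R^-1] gives a closed [K] and
    loses the mass of a strip of values of [f]; this mass is the same for every [n] and vanishes as
    [k] grows. *)
Lemma uregular_sublevel (f : 'M[R]_(m, d) -> R) (q : R) : continuous f ->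
  (forall n (B : set R), measurable B ->
     gam n (f @^-1` B : set (borel_mx R m d)) =
     gam 0%N (f @^-1` B : set (borel_mx R m d))) ->
  uregular gam [set x | f x < q].
Proof.
move=> fc flaw; have oq : @open 'M[R]_(m, d) [set x | f x < q].
  rewrite (_ : [set x | _] = f @^-1` [set y | y < q]) //.
  by apply: open_comp => [y _|]; [exact: fc|exact: open_lt].
split; first exact: measurable_open_mx.
move=> e e0; pose B k : set R := `]q - k.+1%:R^-1, q[%classic.
have mB k : measurable (B k) by exact: measurable_itv.
have mfB k : measurable (f @^-1` B k : set (borel_mx R m d)).
  by rewrite -[X in measurable X]setTI; exact: continuous_measurable_mx.
have [||k ke] := @measure_vanish _ _ _ (gam 0%N) (fun k => f @^-1` B k) e mfB _ _ e0.
- move=> i j ij; apply/subsetPset => x; rewrite /B /= !in_itv /= => /andP[fi ->].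
  rewrite andbT; apply: le_lt_trans fi; rewrite lerD2l lerN2 lef_pV2 ?posrE //.
  by rewrite ler_nat.
- rewrite -subset0 => x fx.
  have fxq : 0 < q - f x by have := fx 0%N Logic.I; rewrite /B /= in_itv subr_gt0 => /andP[].
  have := fx (Num.trunc (q - f x)^-1) Logic.I; rewrite /B /= in_itv /= => /andP[+ _].
  rewrite ltNge => /negP; apply; rewrite lerBrDr -lerBrDl -[leRHS]invrK lef_pV2 ?posrE //.
    by apply: ltW; exact: truncnS_gt.
  by rewrite invr_gt0.
exists [set x | f x <= q - k.+1%:R^-1], [set x | f x < q]; split=> //.
- rewrite (_ : [set x | _] = f @^-1` [set y | y <= q - k.+1%:R^-1]) //.
  by apply: closed_comp => [y _|]; [exact: fc|exact: closed_le].
- move=> x /= /le_lt_trans; apply; rewrite ltrBlDr ltrDl invr_gt0 //.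
- move=> n; rewrite (_ : _ `\` _ = f @^-1` B k) ?flaw //.
  apply/seteqP; split=> x /=; rewrite /B /= in_itv /=.
    by move=> [-> /negP]; rewrite -ltNge andbT.
  by move=> /andP[kf ->]; split=> //; apply/negP; rewrite -ltNge.
Qed.

Hypothesis law : forall n i j (B : set R), measurable B ->
  gam n [set x : borel_mx R m d | B ((x : 'M[R]_(m, d)) i j)] =
  gam 0%N [set x : borel_mx R m d | B ((x : 'M[R]_(m, d)) i j)].

Lemma uregular_coord (i : 'I_m) (j : 'I_d) (a b : R) :
  uregular gam [set x | a < (x : 'M[R]_(m, d)) i j < b].
Proof.
(* The lower bound on an entry is a sublevel condition on its opposite. *)
rewrite (_ : [set x | _] = [set x | - (x : 'M[R]_(m, d)) i j < - a] `&`
    [set x | (x : 'M[R]_(m, d)) i j < b]); last first.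
  apply/seteqP; split=> x /=; first by move=> /andP[? ?]; rewrite ltrN2.
  by rewrite ltrN2 => -[-> ->].
apply: uregularI; apply: uregular_sublevel.
- by move=> x; apply: continuousN; exact: coord_continuous.
- move=> n B mB; apply: (law n i j (B := -%R @^-1` B)).
  rewrite -[X in measurable X]setTI; exact: oppr_measurable.
- exact: coord_continuous.
- by move=> n B mB; exact: law.
Qed.

Lemma uregular_bigcap (I : finType) (F : I -> set (borel_mx R m d)) :
  (forall i, uregular gam (F i)) -> uregular gam [set x | forall i, F i x].
Proof.
move=> rF; have -> : [set x | forall i, F i x] = \big[setI/setT]_i F i.
  apply/seteqP; split=> x; first by move=> Fx; elim/big_ind : _ => // A B; split.
  by move=> + i; rewrite (bigD1 i) //= => -[].
elim/big_ind : _ => // [|A B]; last exact: uregularI.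
by rewrite -setC0; apply: uregularC; exact: uregular0.
Qed.

Lemma uregular_row_rbox (i : 'I_m) (ab : 'rV[rat]_d * 'rV[rat]_d) :
  uregular gam [set x | rbox ab (row i (x : 'M[R]_(m, d)))].
Proof.
rewrite (_ : [set x | _] = [set x | forall j,
    [set x | ratr (ab.1 0 j) < (x : 'M[R]_(m, d)) i j < ratr (ab.2 0 j)] x]).
  by apply: uregular_bigcap => j; exact: uregular_coord.
apply/seteqP; split=> x xab => [j|k j]; first by have := xab 0 j; rewrite mxE.
by rewrite ord1 mxE; exact: xab.
Qed.

Lemma uregular_rbox ab : uregular gam (@rbox R m d ab).
Proof.
apply: (@uregular_bigcap _ (fun i => [set x | forall j,
  ratr (ab.1 i j) < (x : 'M[R]_(m, d)) i j < ratr (ab.2 i j)])) => i.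
by apply: uregular_bigcap => j; exact: uregular_coord.
Qed.

(** A bound on one entry that cuts off little mass for [gam 0] does so for every [gam n], as the law
    of the entry is fixed. One cube respects all the finitely many bounds. *)
Lemma tight_coord (e : R) : 0 < e -> exists C : set 'M[R]_(m, d),
  [/\ compact C, closed C
    & forall n, (gam n (~` C : set (borel_mx R m d)) <= e%:E)%E].
Proof.
(* One more than the number of entries: [c] is positive even without entries, and errors of [e / c]
   per entry add up to at most [e]. *)
move=> e0; pose c := (#|{: 'I_m * 'I_d}|.+1)%:R : R.
have c0 : 0 < c by rewrite ltr0n.
pose B (M : R) : set R := [set y | M < `|y|].
have mB M : measurable (B M).
  rewrite (_ : B M = Num.norm @^-1` `]M, +oo[).
    rewrite -[X in measurable X]setTI; exact: normr_measurable.
  by apply/seteqP; split=> y; rewrite /B /= in_itv /= andbT.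
pose T (ij : 'I_m * 'I_d) M : set (borel_mx R m d) :=
  [set x | B M ((x : 'M[R]_(m, d)) ij.1 ij.2)].
have mT ij M : measurable (T ij M).
  by rewrite -[X in measurable X]setTI; exact: (@measurable_coord R m d ij.1 ij.2 _ _ (mB M)).
have /choice[M MP] (ij : 'I_m * 'I_d) : exists M : nat,
    (gam 0%N (T ij M%:R) <= (e / c)%:E)%E.
  apply: measure_vanish => [k|i j ij'||] //; last by rewrite divr_gt0.
  - by apply/subsetPset => x; apply: le_lt_trans; rewrite ler_nat.
  - rewrite -subset0 => x /(_ (Num.trunc `|(x : 'M[R]_(m, d)) ij.1 ij.2|).+1 Logic.I).
    by rewrite /T /B /= ltNge => /negP; apply; apply: ltW; exact: truncnS_gt.
pose K : nat := (\sum_ij M ij)%N; exists [set x | forall i j, `|x i j| <= K%:R].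
have cK : closed [set x : 'M[R]_(m, d) | forall i j, `|x i j| <= K%:R].
  rewrite (_ : [set x | _] = \bigcap_(ij in [set: 'I_m * 'I_d])
    ((fun x : 'M[R]_(m, d) => `|x ij.1 ij.2|) @^-1` [set y | y <= K%:R])).
    apply: closed_bigI => ij _; apply: closed_comp => [x _|]; last exact: closed_le.
    by apply: continuous_comp; [exact: coord_continuous|exact: norm_continuous].
  by apply/seteqP; split=> x xK => [ij _|i j]; [exact: xK|exact: (xK (i, j))].
split=> //; first exact: compact_cbox.
move=> n; apply: (@le_trans _ _ (gam n (\big[setU/set0]_ij T ij (M ij)%:R))).
  apply: le_measure; rewrite ?inE.
  - by apply: measurableC; exact: measurable_closed_mx.
  - by apply: bigsetU_measurable => ij _.
  - move=> x /= /existsNP[i /existsNP[j /negP]]; rewrite -ltNge => Kx.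
    rewrite (bigD1 (i, j)) //=; left; apply: le_lt_trans Kx.
    by rewrite ler_nat /K (bigD1 (i, j)) //= leq_addr.
apply: le_trans (measure_bigsetU_le _ _ _) _ => //.
apply: (@le_trans _ _ (\sum_(ij : 'I_m * 'I_d) (e / c)%:E)%E).
  apply: lee_sum => ij _; have := law n ij.1 ij.2 (mB (M ij)%:R).
  by rewrite -/(T ij _) => ->; exact: MP.
rewrite sumEFin lee_fin sumr_const -mulr_natr -mulrA ler_piMr ?ltW //.
by rewrite mulrC ltr_pdivrMr // mul1r ltr_nat.
Qed.

End constant_coordinate_laws.

(** * Compactness of couplings and existence of optimal ones *)

Section couplings_compactness.
Context (R : realType) (N d : nat) (mu : 'I_N -> probability (borel_rV R d) R).

Lemma coupling_coord (gam : probability (borel_mx R N d) R) :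
  couplings mu gam -> forall i j (B : set R), measurable B ->
  gam [set x : borel_mx R N d | B ((x : 'M[R]_(N, d)) i j)] =
  mu i [set y : borel_rV R d | B ((y : 'rV[R]_d) 0 j)].
Proof.
move=> gmu i j B mB; rewrite -gmu.
  by congr (gam _); apply/seteqP; split=> x /=; rewrite mxE.
by rewrite -[X in measurable X]setTI; exact: (@measurable_coord R 1 d 0 j _ _ mB).
Qed.

Lemma couplings_rbox (gam : probability (borel_mx R N d) R) :
  (forall i ab, gam [set x : borel_mx R N d | rbox ab (row i (x : 'M[R]_(N, d)))] =
     mu i (rbox ab)) ->
  couplings mu gam.
Proof.
move=> gmu i A mA.
have [Q QE] := push_probability gam (@measurable_row R N d i).
rewrite /pushforward -QE; apply: eq_measure_rbox => //.
  by apply: le_lt_trans (probability_le1 Q measurableT) _; rewrite ltry.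
by move=> ab; exact: etrans (QE _) (gmu i ab).
Qed.

Context (gam : nat -> probability (borel_mx R N d) R).
Hypothesis gam_mu : forall n, couplings mu (gam n).

Let law n i j (B : set R) : measurable B ->
  gam n [set x : borel_mx R N d | B ((x : 'M[R]_(N, d)) i j)] =
  gam 0%N [set x : borel_mx R N d | B ((x : 'M[R]_(N, d)) i j)].
Proof. by move=> mB; rewrite !coupling_coord. Qed.

(** Couplings of the same marginals share their entry laws, which yields tightness and the
    regularity of boxes. The mass of a box condition on one row is constant along the sequence, so
    the limit has the same marginals. *)
Lemma couplings_limit (U : set_system nat) (UU : UltraFilter U) :
  exists2 g : probability (borel_mx R N d) R, couplings mu g &
    forall A, uregular gam A -> g A = (ulim gam U A)%:E.
Proof.
have [g gE] := ulim_measure (U := U) (tight_coord law) (uregular_rbox law).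
exists g => //; apply: couplings_rbox => i ab.
rewrite gE; last exact: (uregular_row_rbox law).
have mab : measurable (rbox ab : set (borel_rV R d)) by exact: measurable_rbox.
rewrite -(fineK (fin_num_measure (mu i) _ mab)); congr EFin.
apply: ulim_const; last by apply: filterE => n /=; congr fine; exact: (gam_mu n i mab).
by rewrite -[X in measurable X]setTI; exact: measurable_row mab.
Qed.

Lemma couplings_uregular_rbox ab : uregular gam (@rbox R N d ab).
Proof. exact: uregular_rbox law ab. Qed.

Lemma couplings_uregular_row_rbox i ab :
  uregular gam [set x | rbox ab (row i (x : 'M[R]_(N, d)))].
Proof. exact: uregular_row_rbox law i ab. Qed.

End couplings_compactness.

(** The direct method: a minimizing sequence has a weak limit among the couplings, and the cost is
    lower semicontinuous along it. *)
Lemma minimizers_couplings (R : realType) (N d : nat)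
    (mu : 'I_N -> probability (borel_rV R d) R) (c : 'M[R]_(N, d) -> R) :
  continuous c -> (forall x, 0 <= c x) -> couplings mu !=set0 ->
  minimizers (couplings mu) (fun gam : probability (borel_mx R N d) R =>
    \int[gam]_(x in [set: borel_mx R N d]) (c x)%:E)%E !=set0.
Proof.
move=> cc c0 [gam0 gam0_mu].
pose J (gam : probability (borel_mx R N d) R) :=
  (\int[gam]_(x in [set: borel_mx R N d]) (c x)%:E)%E.
pose l := ereal_inf (J @` couplings mu).
have l_lb gam : couplings mu gam -> (l <= J gam)%E.
  by move=> ?; apply: ereal_inf_lbound; exists gam.
have l0 : (0 <= l)%E.
  apply: le_ereal_inf_tmp => _ [gam _ <-].
  by apply: integral_ge0 => x _; rewrite lee_fin.
suff [gam gmu Jl] : exists2 gam, couplings mu gam & (J gam <= l)%E.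
  by exists gam; split=> // gam' /l_lb; exact: le_trans.
(* If the infimum is infinite, any coupling attains it. *)
have [ly|lfin] := eqVneq l +oo%E; first by exists gam0 => //; rewrite ly leey.
have lf : l \is a fin_num by rewrite ge0_fin_numE // lt_neqAle lfin leey.
have /choice[gam gamP] (n : nat) : exists gam, couplings mu gam /\
    (J gam <= l + (n.+1%:R^-1)%:E)%E.
  have [|_ [gam ? <-] Jl] := @lb_ereal_inf_adherent _ (J @` couplings mu) n.+1%:R^-1 _ lf.
    by rewrite invr_gt0.
  by exists gam; split=> //; exact: ltW.
have [U [UU ooU]] := ultraFilterLemma (eventually_filter).
have gam_mu n : couplings mu (gam n) by have [] := gamP n.
have [g gmu gE] := couplings_limit gam_mu UU.
(* [U] contains every set of all large indices, and there the costs are below [l + e]. *)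
exists g => //; apply/lee_addgt0Pr => e e0.
apply: (ulim_fatou (couplings_uregular_rbox gam_mu) gE cc c0).
apply: ooU; near=> n; apply: le_trans (gamP n).2 _.
rewrite leeD2l // lee_fin; apply: ltW; near: n.
exact: near_infty_natSinv_lt (PosNum e0).
Unshelve. all: by end_near. Qed.

(** * Gluing *)

Definition cons_mx (T : Type) (m d : nat) (y : 'rV[T]_d) (x : 'M[T]_(m, d)) :
    'M[T]_(m.+1, d) :=
  \matrix_(i, j) if unlift ord0 i is Some k then x k j else y 0 j.

Lemma row_cons_mx0 (T : Type) (m d : nat) (y : 'rV[T]_d) (x : 'M[T]_(m, d)) :
  row ord0 (cons_mx y x) = y.
Proof. by apply/rowP => j; rewrite !mxE unlift_none. Qed.

Lemma row_cons_mxS (T : Type) (m d : nat) (y : 'rV[T]_d) (x : 'M[T]_(m, d)) i :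
  row (lift ord0 i) (cons_mx y x) = row i x.
Proof. by apply/rowP => j; rewrite !mxE liftK. Qed.

(** The product measure, built by induction: an independent row is put in front of a coupling of the
    remaining marginals. *)
Lemma couplings_nonempty (R : realType) (N d : nat)
    (mu : 'I_N -> probability (borel_rV R d) R) : couplings mu !=set0.
Proof.
elim: N mu => [|N IHN] mu.
  (* Without marginals, the point mass at the matrix with no rows will do. *)
  by exists (@dirac _ (borel_mx R 0 d) (0 : 'M[R]_(0, d)) R) => -[].
have [gam gam_mu] := IHN (fun i => mu (lift ord0 i)).
pose f (yx : borel_rV R d * borel_mx R N d) : borel_mx R N.+1 d :=
  cons_mx (yx.1 : 'rV[R]_d) (yx.2 : 'M[R]_(N, d)).
have mf : measurable_fun setT f.
  apply: measurable_to_mx => i j; rewrite /f /cons_mx.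
  under eq_fun do rewrite mxE; case: unlift => [k|].
  - by apply: (measurableT_comp (@measurable_coord R N d k j) measurable_snd).
  - by apply: (measurableT_comp (@measurable_coord R 1 d 0 j) measurable_fst).
pose P : probability (borel_rV R d * borel_mx R N d)%type R :=
  (mu ord0 \x gam)%E.
have [Q QE] := push_probability P mf.
exists Q => i A mA; rewrite /pushforward QE.
case: (unliftP ord0 i) => [k|] ->.
- rewrite (_ : f @^-1` _ = setT `*` (row k @^-1` A)); last first.
    apply/seteqP; split=> [[y x]|[y x]] /=; rewrite /f row_cons_mxS //.
    by move=> [].
  have mrA : measurable (row k @^-1` A : set (borel_mx R N d)).
    by rewrite -[X in measurable X]setTI; exact: measurable_row mA.
  rewrite [LHS](_ : _ = mu ord0 setT * gam (row k @^-1` A))%E; last first.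
    exact: product_measure1E.
  by rewrite probability_setT mul1e; exact: gam_mu mA.
- rewrite (_ : f @^-1` _ = A `*` setT); last first.
    apply/seteqP; split=> [[y x]|[y x]] /=; rewrite /f row_cons_mx0 //.
    by move=> [].
  rewrite [LHS](_ : _ = mu ord0 A * gam setT)%E; last exact: product_measure1E.
  by rewrite probability_setT mule1.
Qed.

Lemma measure_splitI d (T : measurableType d) (R : realType)
    (mu : {measure set T -> \bar R}) (A D : set T) :
  measurable A -> measurable D -> mu A = (mu (A `&` D) + mu (A `&` ~` D))%E.
Proof.
move=> mA mD; transitivity (mu ((A `&` D) `|` (A `&` ~` D))).
  by rewrite -setIUr setUCr setIT.
have mC := measurableC mD.
apply: (measureU mu); [exact: measurableI|exact: measurableI|].
by rewrite setIACA setICr setI0.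
Qed.

Lemma measurable_row_preimage (R : realType) (m d : nat) (i : 'I_m)
    (S : set (borel_rV R d)) : measurable S ->
  measurable ((row i : borel_mx R m d -> borel_rV R d) @^-1` S).
Proof. by move=> mS; rewrite -[X in measurable X]setTI; exact: measurable_row mS. Qed.

Lemma measure_row_mass (R : realType) (m d : nat) (i : 'I_m)
    (eta : {measure set (borel_mx R m d) -> \bar R})
    (nu : {measure set (borel_rV R d) -> \bar R}) :
  (forall S, measurable S ->
    eta ((row i : borel_mx R m d -> borel_rV R d) @^-1` S) = nu S) ->
  eta setT = nu setT.
Proof. by move=> /(_ setT measurableT); rewrite preimage_setT. Qed.

Lemma measure_null_sub d (T : measurableType d) (R : realType)
    (mu : {measure set T -> \bar R}) (A D : set T) :
  measurable A -> measurable D -> A `<=` D -> mu D = 0%E -> mu A = 0%E.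
Proof.
move=> mA mD AD D0; apply/eqP; rewrite -measure_le0 -D0.
by apply: le_measure; rewrite ?inE.
Qed.

(** With no box to respect, only the laws of single rows are prescribed: a coupling of the
    normalized laws, rescaled by their common mass, has them. Null mass cannot be normalized and is
    settled by the zero measure. *)
Lemma gluing_base (R : realType) (N d : nat)
    (nu : {measure set (borel_rV R d) -> \bar R})
    (eta : 'I_N -> {measure set (borel_mx R 2 d) -> \bar R}) :
  (nu setT < +oo)%E ->
  (forall i S, measurable S ->
    eta i ((row 1 : borel_mx R 2 d -> borel_rV R d) @^-1` S) = nu S) ->
  exists Gam : {measure set (borel_mx R N.+1 d) -> \bar R},
    (forall S, measurable S ->
      Gam ((row ord0 : borel_mx R N.+1 d -> borel_rV R d) @^-1` S) = nu S) /\
    (forall i S, measurable S ->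
      Gam ((row (lift ord0 i) : borel_mx R N.+1 d -> borel_rV R d) @^-1` S) =
      eta i ((row 0 : borel_mx R 2 d -> borel_rV R d) @^-1` S)).
Proof.
move=> nuT eta_nu; have eta_T i := measure_row_mass (eta_nu i).
have [nu0|nu0] := eqVneq (nu setT) 0%E.
  exists mzero; split=> [S mS|i S mS]; apply/esym.
    exact: measure_null_sub nu0.
  apply: (@measure_null_sub _ _ _ (eta i) _ setT) => //.
    exact: measurable_row_preimage.
  by rewrite eta_T.
have nuf : nu setT \is a fin_num by rewrite ge0_fin_numE.
have [gam gamP] := couplings_nonempty (fun i : 'I_N.+1 =>
  if unlift ord0 i is Some k then
    projT1 (cid (push_probability (mnormalize (eta k) (dirac point)) (@measurable_row R 2 d 0)))
  else mnormalize nu (dirac point)).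
have c0 : 0 <= fine (nu setT) by rewrite fine_ge0.
have normE d' (T : measurableType d') (m : {measure set T -> \bar R}) P S :
    m setT = nu setT -> ((fine (nu setT))%:E * mnormalize m P S = m S)%E.
  move=> mT; rewrite /mnormalize mT (negbTE nu0) /= lt_eqF //.
  rewrite muleCA -EFinM divff ?mule1 //.
  by apply: contra nu0; rewrite -eqe fineK.
have scaleE S v : gam S = v -> mscale (NngNum c0) gam S = ((fine (nu setT))%:E * v)%E.
  by move=> <-.
exists (mscale (NngNum c0) gam); split=> [S mS|i S mS].
  have gS := gamP ord0 S mS; rewrite unlift_none in gS.
  by apply: etrans (scaleE _ _ gS) _; exact: normE.
have gS := gamP (lift ord0 i) S mS; rewrite liftK in gS.
apply: etrans (scaleE _ _ gS) _; case: cid => Q /= ->.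
by apply: normE; exact: eta_T.
Qed.

Lemma gluing_finite (R : realType) (N d : nat) (B : (set (borel_rV R d))^nat)
    (n : nat) (nu : {measure set (borel_rV R d) -> \bar R})
    (eta : 'I_N -> {measure set (borel_mx R 2 d) -> \bar R}) :
  (forall k, measurable (B k)) -> (nu setT < +oo)%E ->
  (forall i S, measurable S ->
    eta i ((row 1 : borel_mx R 2 d -> borel_rV R d) @^-1` S) = nu S) ->
  exists Gam : {measure set (borel_mx R N.+1 d) -> \bar R},
    [/\ forall S, measurable S ->
          Gam ((row ord0 : borel_mx R N.+1 d -> borel_rV R d) @^-1` S) = nu S,
        forall i S, measurable S ->
          Gam ((row (lift ord0 i) : borel_mx R N.+1 d -> borel_rV R d) @^-1` S) =
          eta i ((row 0 : borel_mx R 2 d -> borel_rV R d) @^-1` S)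
      & forall i S k, measurable S -> (k < n)%N ->
          Gam ((row (lift ord0 i) : borel_mx R N.+1 d -> borel_rV R d) @^-1` S `&`
               (row ord0 : borel_mx R N.+1 d -> borel_rV R d) @^-1` B k) =
          eta i ((row 0 : borel_mx R 2 d -> borel_rV R d) @^-1` S `&`
                 (row 1 : borel_mx R 2 d -> borel_rV R d) @^-1` B k)].
Proof.
(* The plans are cut along [B n] and its complement, and the two gluings added. *)
move=> mB; elim: n nu eta => [|n IHn] nu eta nuT eta_nu.
  by have [Gam [G0 G1]] := gluing_base nuT eta_nu; exists Gam.
have mD := mB n; have mD' := measurableC mD.
have mR1 S : measurable S ->
    measurable ((row 1 : borel_mx R 2 d -> borel_rV R d) @^-1` S).
  exact: measurable_row_preimage.
have mR0 S : measurable S ->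
    measurable ((row 0 : borel_mx R 2 d -> borel_rV R d) @^-1` S).
  exact: measurable_row_preimage.
(* Restricting to [D] changes the total mass, which is why the induction runs over finite measures
   rather than probabilities. *)
have split_gluing D (mD1 : measurable D) : exists Gam : {measure set (borel_mx R N.+1 d) -> \bar R},
    [/\ forall S, measurable S ->
          Gam ((row ord0 : borel_mx R N.+1 d -> borel_rV R d) @^-1` S) = nu (S `&` D),
        forall i S, measurable S ->
          Gam ((row (lift ord0 i) : borel_mx R N.+1 d -> borel_rV R d) @^-1` S) =
          eta i ((row 0 : borel_mx R 2 d -> borel_rV R d) @^-1` S `&`
            (row 1 : borel_mx R 2 d -> borel_rV R d) @^-1` D)
      & forall i S k, measurable S -> (k < n)%N ->
          Gam ((row (lift ord0 i) : borel_mx R N.+1 d -> borel_rV R d) @^-1` S `&`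
               (row ord0 : borel_mx R N.+1 d -> borel_rV R d) @^-1` B k) =
          eta i ((row 0 : borel_mx R 2 d -> borel_rV R d) @^-1` S `&`
                 (row 1 : borel_mx R 2 d -> borel_rV R d) @^-1` B k `&`
                 (row 1 : borel_mx R 2 d -> borel_rV R d) @^-1` D)].
  apply: (IHn (mrestr nu mD1) (fun i => mrestr (eta i) (mR1 _ mD1))).
    apply: le_lt_trans nuT; rewrite /mrestr.
    by apply: le_measure; rewrite ?inE //; exact: measurableI.
  by move=> i S mS; exact: (eta_nu i _ (measurableI _ _ mS mD1)).
have [G1 [G1z G1x G1B]] := split_gluing _ mD.
have [G0 [G0z G0x G0B]] := split_gluing _ mD'.
have addE A a b : G1 A = a -> G0 A = b -> measure_add G1 G0 A = (a + b)%E.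
  by move=> <- <-; exact: measure_addE.
exists (measure_add G1 G0); split=> [S mS|i S mS|i S k mS].
- by apply: etrans (addE _ _ _ (G1z S mS) (G0z S mS)) _; exact/esym/measure_splitI.
- apply: etrans (addE _ _ _ (G1x i S mS) (G0x i S mS)) _.
  by rewrite preimage_setC; apply/esym/measure_splitI; [exact: mR0|exact: mR1].
rewrite ltnS leq_eqVlt => /orP[/eqP->|kn]; last first.
  apply: etrans (addE _ _ _ (G1B i S k mS kn) (G0B i S k mS kn)) _.
  rewrite preimage_setC; apply/esym/measure_splitI; last exact: mR1.
  by apply: measurableI; [exact: mR0|exact: mR1].
have mxS := @measurable_row_preimage R N.+1 d (lift ord0 i) S mS.
have mzD := @measurable_row_preimage R N.+1 d ord0 _ mD.
have mzD' := measurableC mzD.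
(* For [k = n], the gluing over the complement of [B n] puts no mass on [B n], and the gluing over
   [B n] puts none outside, so the row law of [G1] already gives the required value. *)
have G0D : G0 ((row (lift ord0 i) : borel_mx R N.+1 d -> borel_rV R d) @^-1` S `&`
    (row ord0 : borel_mx R N.+1 d -> borel_rV R d) @^-1` B n) = 0%E.
  apply: measure_null_sub (measurableI _ _ mxS mzD) mzD _ _ => //.
  by apply: etrans (G0z _ mD) _; rewrite setICr measure0.
have G1D' : G1 ((row (lift ord0 i) : borel_mx R N.+1 d -> borel_rV R d) @^-1` S `&`
    ~` ((row ord0 : borel_mx R N.+1 d -> borel_rV R d) @^-1` B n)) = 0%E.
  apply: measure_null_sub (measurableI _ _ mxS mzD') mzD' _ _ => //.
  by apply: etrans (G1z _ mD') _; rewrite setICl measure0.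
apply: etrans (addE _ _ _ erefl G0D) _.
apply: etrans (G1x i S mS); rewrite adde0.
by apply: etrans (esym (measure_splitI G1 mxS mzD)); rewrite G1D' adde0.
Qed.

Definition rows2 (T : Type) (m d : nat) (a b : 'I_m) (x : 'M[T]_(m, d)) :
    'M[T]_(2, d) :=
  \matrix_(k, j) x (if k == 0 then a else b) j.

Lemma row0_rows2 (T : Type) (m d : nat) (a b : 'I_m) (x : 'M[T]_(m, d)) :
  row 0 (rows2 a b x) = row a x.
Proof. by apply/rowP => j; rewrite !mxE. Qed.

Lemma row1_rows2 (T : Type) (m d : nat) (a b : 'I_m) (x : 'M[T]_(m, d)) :
  row 1 (rows2 a b x) = row b x.
Proof. by apply/rowP => j; rewrite !mxE. Qed.

Lemma rows2_id (T : Type) (d : nat) (x : 'M[T]_(2, d)) : rows2 0 1 x = x.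
Proof.
apply/matrixP => k j; rewrite mxE; congr (x _ j).
by apply: val_inj; case: k => [[|[|]]].
Qed.

Lemma measurable_rows2 (R : realType) (m d : nat) (a b : 'I_m) :
  measurable_fun setT (rows2 a b : borel_mx R m d -> borel_mx R 2 d).
Proof.
apply: measurable_to_mx => k j; rewrite /rows2; under eq_fun do rewrite mxE.
exact: measurable_coord.
Qed.

Lemma rbox_rows2 (R : realType) (m d : nat) (a b : 'I_m)
    (ab : 'M[rat]_(2, d) * 'M[rat]_(2, d)) (x : 'M[R]_(m, d)) :
  rbox ab (rows2 a b x) <->
  rbox (row 0 ab.1, row 0 ab.2) (row a x) /\ rbox (row 1 ab.1, row 1 ab.2) (row b x).
Proof.
split=> [xab|[xa xb] k j].
  split=> i j; rewrite ord1 !mxE; first by have := xab 0 j; rewrite mxE.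
  by have := xab 1 j; rewrite mxE.
rewrite mxE; case: (splitP (k : 'I_(1 + 1))) => l kl.
  have -> : k = 0 by apply: val_inj; rewrite /= kl ord1.
  by have := xa 0 j; rewrite !mxE.
have -> : k = 1 by apply: val_inj; rewrite /= kl ord1.
by have := xb 0 j; rewrite !mxE.
Qed.

Lemma measure_probability d (T : measurableType d) (R : realType)
    (m : {measure set T -> \bar R}) :
  m setT = 1%E -> exists P : probability T R, forall A, P A = m A.
Proof.
(* Normalization divides by 1 here; its default [dirac point] is never reached. *)
move=> mT; exists (mnormalize m (dirac point)) => A.
by rewrite /= /mnormalize mT onee_eq0 /= invr1 mule1.
Qed.

(** The partial gluings share their row laws, so they have a limit [g]. The event that two given
    rows lie in two given boxes is uniformly regular, and its mass is eventually the one prescribed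
    by [eta i]. Hence the pair of rows has law [eta i] on boxes, and then on all Borel sets. *)
Theorem gluing (R : realType) (N d : nat) (nu : probability (borel_rV R d) R)
    (eta : 'I_N -> probability (borel_mx R 2 d) R) :
  (forall i S, measurable S ->
    eta i ((row 1 : borel_mx R 2 d -> borel_rV R d) @^-1` S) = nu S) ->
  exists2 Gam : probability (borel_mx R N.+1 d) R,
    forall S, measurable S ->
      Gam ((row ord0 : borel_mx R N.+1 d -> borel_rV R d) @^-1` S) = nu S &
    forall i A, measurable A ->
      Gam ((rows2 (lift ord0 i) ord0 : borel_mx R N.+1 d -> borel_mx R 2 d) @^-1` A) =
      eta i A.
Proof.
move=> eta_nu.
(* All rational boxes listed as a sequence, with the empty set at the codes of no box. *)
pose B k : set (borel_rV R d) := if unpickle k is Some ab then rbox ab else set0.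
have mB k : measurable (B k).
  by rewrite /B; case: unpickle => [ab|] //; exact: measurable_rbox.
have nuT : (nu setT < +oo)%E.
  by apply: le_lt_trans (probability_le1 nu measurableT) _; rewrite ltry.
have /choice[gam gamP] (n : nat) : exists Gam : probability (borel_mx R N.+1 d) R,
    [/\ forall S, measurable S ->
          Gam ((row ord0 : borel_mx R N.+1 d -> borel_rV R d) @^-1` S) = nu S,
        forall i S, measurable S ->
          Gam ((row (lift ord0 i) : borel_mx R N.+1 d -> borel_rV R d) @^-1` S) =
          eta i ((row 0 : borel_mx R 2 d -> borel_rV R d) @^-1` S)
      & forall i S k, measurable S -> (k < n)%N ->
          Gam ((row (lift ord0 i) : borel_mx R N.+1 d -> borel_rV R d) @^-1` S `&`
               (row ord0 : borel_mx R N.+1 d -> borel_rV R d) @^-1` B k) =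
          eta i ((row 0 : borel_mx R 2 d -> borel_rV R d) @^-1` S `&`
                 (row 1 : borel_mx R 2 d -> borel_rV R d) @^-1` B k)].
  have [Gam GamP] := @gluing_finite R N d B n nu eta mB nuT eta_nu.
  have GamT : Gam setT = 1%E.
    by have [G0 _ _] := GamP; exact: etrans (measure_row_mass G0) (probability_setT nu).
  have [P PE] := measure_probability GamT; have [G0 G1 GB] := GamP.
  exists P; split=> [S mS|l S mS|l S k mS kn]; apply: etrans (PE _) _.
  - exact: G0.
  - exact: G1.
  - exact: GB.
(* The row laws do not depend on [n]; naming them [rho] makes every [gam n] a coupling of the same
   family. *)
have /choice[rho rhoP] (i : 'I_N.+1) : exists Q : probability (borel_rV R d) R,
    forall S, measurable S -> forall n,
    gam n ((row i : borel_mx R N.+1 d -> borel_rV R d) @^-1` S) = Q S.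
  case: (unliftP ord0 i) => [k|] ->.
    have [Q QE] := push_probability (eta k) (@measurable_row R 2 d 0).
    by exists Q => S mS n; have [_ Gx _] := gamP n; exact: etrans (Gx k S mS) (esym (QE _)).
  by exists nu => S mS n; have [G0 _ _] := gamP n; exact: G0.
have gam_rho n : couplings rho (gam n) by move=> i S mS; exact: rhoP.
have [U [UU ooU]] := ultraFilterLemma eventually_filter.
have [g g_rho gE] := couplings_limit gam_rho UU.
exists g => [S mS|i A mA].
  apply: etrans (g_rho ord0 S mS) _; rewrite -(rhoP _ _ mS 0%N).
  by have [G0 _ _] := gamP 0%N; exact: G0.
have [Q QE] := push_probability g (@measurable_rows2 R N.+1 d (lift ord0 i) ord0).
rewrite -QE; apply: eq_measure_rbox => //.
  by apply: le_lt_trans (probability_le1 Q measurableT) _; rewrite ltry.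
move=> ab; apply: etrans (QE _) _.
set a := (row 0 ab.1, row 0 ab.2); set b := (row 1 ab.1, row 1 ab.2).
have gab (x : 'M[R]_(N.+1, d)) : rbox ab (rows2 (lift ord0 i) ord0 x) =
    (rbox a (row (lift ord0 i) x) /\ rbox b (row ord0 x)).
  by apply/propext; exact: rbox_rows2.
rewrite (_ : _ @^-1` _ =
    [set x | rbox a (row (lift ord0 i) (x : 'M[R]_(N.+1, d)))] `&`
    [set x | rbox b (row ord0 (x : 'M[R]_(N.+1, d)))]); last first.
  by apply/seteqP; split=> x /=; rewrite gab.
have rab := uregularI (couplings_uregular_row_rbox gam_rho (lift ord0 i) a)
                      (couplings_uregular_row_rbox gam_rho ord0 b).
rewrite gE //.
have mab : measurable (rbox ab : set (borel_mx R 2 d)) by exact: measurable_rbox.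
apply: (@etrans _ _ (fine (eta i (rbox ab)))%:E); last first.
  exact: (fineK (fin_num_measure (eta i) _ mab)).
congr EFin; apply: ulim_const => //; first exact: rab.1.
have ma : measurable (rbox a : set (borel_rV R d)) by exact: measurable_rbox.
(* From the successor of its code on, the box [b] is among the first [n] boxes, where [gam n] glues
   correctly. *)
apply: ooU; exists (pickle b).+1 => // n /= bn.
have [_ _ GB] := gamP n; have := GB i _ (pickle b) ma bn; rewrite /B pickleK => ->.
congr (fine (eta i _)); apply/seteqP; split=> x /=;
  have := rbox_rows2 0 1 ab (x : 'M[R]_(2, d)); rewrite rows2_id.
  by move=> [_ xab] /xab.
by move=> [xab _] /xab.
Qed.

(** * Barycenters of points *)

Section euclidean_norm.
Context (R : realType) (d : nat).
Implicit Types x y : 'rV[R]_d.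

Lemma enorm_ge0 x : 0 <= enorm x.
Proof. exact: sqrtr_ge0. Qed.

Lemma enorm_sqr x : enorm x ^+ 2 = \sum_j x 0 j ^+ 2.
Proof. by rewrite sqr_sqrtr // sumr_ge0 // => j _; exact: sqr_ge0. Qed.

Lemma enormN x : enorm (- x) = enorm x.
Proof. by congr Num.sqrt; apply: eq_bigr => j _; rewrite mxE sqrrN. Qed.

Lemma enorm0 : enorm (0 : 'rV[R]_d) = 0.
Proof. by rewrite /enorm big1 ?sqrtr0 // => j _; rewrite mxE expr0n. Qed.

Lemma coord_le_enorm x j : `|x 0 j| <= enorm x.
Proof.
rewrite -sqrtr_sqr ler_sqrt ?sumr_ge0 //; last by move=> k _; exact: sqr_ge0.
by rewrite (bigD1 j) //= lerDl sumr_ge0 // => k _; exact: sqr_ge0.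
Qed.

Lemma enorm_gt0 x : x != 0 -> 0 < enorm x.
Proof.
move=> x0; rewrite lt_neqAle enorm_ge0 andbT; apply: contra_neq x0 => x0.
apply/rowP => j; rewrite mxE; apply/eqP; rewrite -normr_le0 x0.
exact: coord_le_enorm.
Qed.

(** For nonzero vectors of norms [a] and [b], expanding the nonnegative sum of squares of
    [b * x 0 j - a * y 0 j] gives the difference of the two sides times [2 * a * b]. *)
Lemma cauchy_schwarz x y : \sum_j x 0 j * y 0 j <= enorm x * enorm y.
Proof.
have [->|x0] := eqVneq x 0; first by rewrite enorm0 mul0r big1 // => j _; rewrite mxE mul0r.
have [->|y0] := eqVneq y 0; first by rewrite enorm0 mulr0 big1 // => j _; rewrite mxE mulr0.
have a0 := enorm_gt0 x0; have b0 := enorm_gt0 y0.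
set a := enorm x in a0 *; set b := enorm y in b0 *.
have ab0 : 0 < 2 * a * b by rewrite !mulr_gt0.
rewrite -subr_ge0 -(pmulr_rge0 _ ab0).
have -> : 2 * a * b * (a * b - \sum_j x 0 j * y 0 j) =
    \sum_j (b * x 0 j - a * y 0 j) ^+ 2.
  rewrite [RHS](eq_bigr (fun j => b ^+ 2 * x 0 j ^+ 2 - 2 * a * b * (x 0 j * y 0 j) +
    a ^+ 2 * y 0 j ^+ 2)); last by move=> j _; ring.
  rewrite big_split sumrB /= -!mulr_sumr -!enorm_sqr -/a -/b; ring.
by rewrite sumr_ge0 // => j _; exact: sqr_ge0.
Qed.

Lemma enormD_le x y : enorm (x + y) <= enorm x + enorm y.
Proof.
rewrite -(ler_pXn2r (n := 2)) ?nnegrE ?addr_ge0 ?enorm_ge0 //.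
rewrite enorm_sqr (eq_bigr (fun j => x 0 j ^+ 2 + 2 * (x 0 j * y 0 j) + y 0 j ^+ 2)).
  rewrite !big_split /= -mulr_sumr -!enorm_sqr sqrrD lerD2r lerD2l -[leRHS]mulr_natl.
  by rewrite ler_pM2l // cauchy_schwarz.
by move=> j _; rewrite !mxE; ring.
Qed.

Lemma enorm_subC x y : enorm (x - y) = enorm (y - x).
Proof. by rewrite -enormN opprB. Qed.

Lemma ler_dist_enorm x y : `|enorm x - enorm y| <= enorm (x - y).
Proof.
have := enormD_le (x - y) y; have := enormD_le (y - x) x.
by rewrite !subrK (enorm_subC y) ler_norml => h1 h2; apply/andP; split; lra.
Qed.

Lemma enorm_parallelogram x y :
  enorm (2^-1 *: (x + y)) ^+ 2 =
  (enorm x ^+ 2 + enorm y ^+ 2) / 2 - enorm (x - y) ^+ 2 / 4.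
Proof.
rewrite !enorm_sqr -big_split /= !mulr_suml -sumrB; apply: eq_bigr => j _.
by rewrite !mxE; field.
Qed.

Lemma enorm_continuous : continuous (@enorm R d).
Proof.
move=> x; apply: (@continuous_comp _ _ _ (fun x : 'rV[R]_d => \sum_j x 0 j ^+ 2) Num.sqrt).
  apply: continuous_big => [|j _] y; first exact: add_continuous.
  apply: (@continuous_comp _ _ _ (fun x : 'rV[R]_d => x 0 j) (fun t => t ^+ 2)).
    exact: coord_continuous.
  exact: exprn_continuous.
exact: sqrt_continuous.
Qed.

End euclidean_norm.

Section real_powers.
Context (R : realType).

Lemma powR_norm_continuous (p : R) : 0 < p -> continuous (fun t : R => `|t| `^ p).
Proof.
move=> p0 x; have [->|x0] := eqVneq x 0.
  rewrite /continuous_at normr0 powR0 ?gt_eqF //; apply/cvgr0Pnorm_lt => e e0.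
  (* At 0 the radius of continuity is the [p]-th root of [e]; elsewhere the power is
     differentiable. *)
  have e'0 : 0 < e `^ p^-1 by rewrite powR_gt0.
  exists (e `^ p^-1) => //= t /=; rewrite sub0r normrN => te.
  rewrite ger0_norm ?powR_ge0 //.
  have -> : e = (e `^ p^-1) `^ p by rewrite -powRrM mulVf ?gt_eqF // powRr1 // ltW.
  by apply: gt0_ltr_powR; rewrite ?nnegrE ?normr_ge0 ?powR_ge0.
apply: (@continuous_comp _ _ _ (fun t : R => `|t|) (fun t => t `^ p)).
  exact: norm_continuous.
apply/differentiable_continuous/derivable1_diffP.
by apply: derivable_powR; rewrite in_itv /= andbT normr_gt0.
Qed.

(** By the mean value theorem on both halves of the segment, the increment is larger on the right,
    since the derivative is strictly increasing for [p > 1]. The case [a = 0], outside the domain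
    where the derivative is taken, is a direct comparison of powers of one half. *)
Lemma powR_midpoint_lt (p a b : R) : 1 < p -> 0 <= a -> a < b ->
  ((a + b) / 2) `^ p < (a `^ p + b `^ p) / 2.
Proof.
move=> p1 a0 ab; have p0 : 0 < p by rewrite (lt_trans _ p1).
have b0 : 0 < b by exact: le_lt_trans ab.
have [az|az] := eqVneq a 0.
  rewrite az add0r powR0 ?gt_eqF // add0r powRM ?(ltW b0) //.
  rewrite ltr_pM2l ?powR_gt0 //.
  rewrite -mulr_powRB1 ?invr_ge0 // -[ltRHS]mulr1 ltr_pM2l ?invr_gt0 //.
  rewrite -[ltRHS](congr1 (@^~ (p - 1)) (@powR1 R)).
  by apply: gt0_ltr_powR; rewrite ?subr_gt0 ?nnegrE ?invf_lt1 ?ltr1n.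
have a0' : 0 < a by rewrite lt_neqAle eq_sym az.
set m := (a + b) / 2.
have am : a < m by rewrite /m; lra.
have mb : m < b by rewrite /m; lra.
have key (u v : R) : 0 < u -> u < v ->
    exists2 c, u < c < v & v `^ p - u `^ p = p * c `^ (p - 1) * (v - u).
  move=> u0 uv.
  have [||c cuv cE] := @MVT R (fun t => t `^ p) (fun t => p * t `^ (p - 1)) u v uv.
  - move=> t; rewrite in_itv /= => /andP[ut _]; apply: is_derive1_powR.
    exact: lt_trans ut.
  - apply: derivable_within_continuous => t; rewrite in_itv /= => /andP[ut _].
    by apply: derivable_powR; rewrite in_itv /= andbT (lt_le_trans u0).
  - by exists c => //; move: cuv; rewrite in_itv.
have [c /andP[ac cm] cE] := key a m a0' am.
have [e /andP[me eb] eE] := key m b (lt_trans a0' am) mb.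
have ce : c `^ (p - 1) < e `^ (p - 1).
  apply: gt0_ltr_powR; rewrite ?subr_gt0 ?nnegrE ?ltW //.
  - exact: lt_trans ac.
  - exact: lt_trans (lt_trans a0' am) me.
  - exact: lt_trans me.
have : m `^ p - a `^ p < b `^ p - m `^ p.
  rewrite cE eE (_ : b - m = m - a); last by rewrite /m; lra.
  by rewrite ltr_pM2r ?subr_gt0 // ltr_pM2l.
lra.
Qed.

End real_powers.

Lemma minimumE disp (T : Type) (V : porderType disp) (v0 : V) (A : set T)
    (f : T -> V) (a : T) :
  minimizers A f a -> minimum v0 A f = f a.
Proof.
move=> fa; have [b fb <-] : (f @` minimizers A f) (minimum v0 A f).
  by apply: xgetPex; exists (f a), a.
by apply: le_anti; rewrite fa.2 ?fb.2 //; [exact: fa.1|exact: fb.1].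
Qed.

(** Beyond 1 a number is at most its [p]-th power. Avoiding roots keeps the bound affine in [c]. *)
Lemma powR_le_linear (R : realType) (p l c t : R) : 1 <= p -> 0 < l -> 0 <= c ->
  l * t `^ p <= c -> t <= c / l + 1.
Proof.
move=> p1 l0 c0; rewrite mulrC -ler_pdivlMr // => tc.
have cl0 : 0 <= c / l by rewrite divr_ge0 // ltW.
rewrite leNgt; apply/negP => ct; have t1 : 1 <= t by lra.
by have := le1r_powR t1 p1; lra.
Qed.

(** Points doing at least as well as 0 lie in a compact cube, so a minimizer over the cube is a
    global one. *)
Lemma coercive_minimizers (R : realType) (d : nat) (f : 'rV[R]_d -> R) (M : R) :
  continuous f -> (forall z, f z <= f 0 -> forall k j, `|z k j| <= M) ->
  minimizers setT f !=set0.
Proof.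
move=> fc fM; have zM : forall k j, `|(0 : 'rV[R]_d) k j| <= M by exact: fM.
have [||z _ zmin] := @compact_EVT_min _ R f
  [set z | forall k j, `|z k j| <= M] _ (@compact_cbox R 1 d M).
- by exists 0.
- exact: continuous_subspaceT.
exists z; split=> // w _.
have [wx|xw] := leP (f w) (f 0); first by apply: zmin; rewrite inE; exact: fM.
by apply: le_trans (ltW xw); apply: zmin; rewrite inE.
Qed.

Lemma midpoint_minimizers_uniq (R : realType) (V : lmodType R) (f : V -> R) (z w : V) :
  (forall u v, u != v -> f (2^-1 *: (u + v)) < (f u + f v) / 2) ->
  minimizers setT f z -> minimizers setT f w -> z = w.
Proof.
move=> fmid [_ zmin] [_ wmin]; apply/eqP/negPn/negP => zw.
have := fmid _ _ zw.
have := zmin (2^-1 *: (z + w)) Logic.I; have := wmin (2^-1 *: (z + w)) Logic.I.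
by move: (f z) (f w) (f _) => a b c; lra.
Qed.

Section barycenters.
Context (R : realType) (N d : nat) (p : R) (lambda : 'I_N -> R).
Hypotheses (p_gt1 : 1 < p) (lambda_gt0 : forall i, 0 < lambda i)
  (lambda_sum1 : \sum_(i < N) lambda i = 1).
Implicit Types (x : 'M[R]_(N, d)) (z : 'rV[R]_d).

Let p_gt0 : 0 < p. Proof. exact: lt_trans p_gt1. Qed.

(** The weights could not sum to 1 over an empty index set. *)
Let i0P : exists i : 'I_N, True.
Proof.
case: N lambda lambda_sum1 => [|n] l l1; last by exists ord0.
by move/eqP: l1; rewrite big_ord0 eq_sym oner_eq0.
Qed.

Lemma dispersion_ge0 x z : 0 <= dispersion p lambda x z.
Proof. by apply: sumr_ge0 => i _; rewrite mulr_ge0 ?powR_ge0 // ltW. Qed.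

Lemma dispersion_ge_term x z i :
  lambda i * enorm (row i x - z) `^ p <= dispersion p lambda x z.
Proof.
rewrite /dispersion (bigD1 i) //= lerDl.
by apply: sumr_ge0 => k _; rewrite mulr_ge0 ?powR_ge0 // ltW.
Qed.

Lemma enorm_powR_continuous (T : topologicalType) (f : T -> 'rV[R]_d) :
  continuous f -> continuous (fun t => enorm (f t) `^ p).
Proof.
move=> fc; rewrite (_ : (fun t => _) = (fun t => `|enorm (f t)| `^ p)); last first.
  by apply/funext => t; rewrite ger0_norm // enorm_ge0.
move=> t; apply: (@continuous_comp _ _ _ (fun t => enorm (f t)) (fun u => `|u| `^ p)).
  by apply: continuous_comp; [exact: fc|exact: enorm_continuous].
exact: powR_norm_continuous.
Qed.

Lemma dispersion_continuous (T : topologicalType) (f : T -> 'M[R]_(N, d))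
    (g : T -> 'rV[R]_d) :
  continuous f -> continuous g ->
  continuous (fun t => dispersion p lambda (f t) (g t)).
Proof.
move=> fc gc; apply: continuous_big => [|i _]; first exact: add_continuous.
suff h : continuous (fun t => enorm (row i (f t) - g t) `^ p).
  by move=> t; apply: cvgMr; exact: h.
apply: enorm_powR_continuous; apply: mx_continuous => k j t.
rewrite (_ : (fun t => _) = (fun t => f t i j - g t k j)); last first.
  by apply/funext => u; rewrite !mxE.
apply: continuousB.
  exact: (@continuous_comp _ _ _ f (fun x : 'M[R]_(N, d) => x i j) t (fc t)
    (@coord_continuous R N d i j (f t))).
exact: (@continuous_comp _ _ _ g (fun x : 'rV[R]_d => x k j) t (gc t)
  (@coord_continuous R 1 d k j (g t))).
Qed.

(** Each term is strictly midpoint convex. If [u] and [v] have different norms, this is strict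
    convexity of the power; if their norms agree, the parallelogram identity makes their midpoint
    strictly shorter. *)
Lemma dispersion_midpoint_lt x z w : z != w ->
  dispersion p lambda x (2^-1 *: (z + w)) <
  (dispersion p lambda x z + dispersion p lambda x w) / 2.
Proof.
move=> zw; rewrite /dispersion -big_split /= mulr_suml; apply: ltr_sum => [|i _].
  by have [i _] := i0P; apply/hasP; exists i => //; exact: mem_index_enum.
rewrite -mulrDr -mulrA ltr_pM2l //.
set u := row i x - z; set v := row i x - w.
have -> : row i x - 2^-1 *: (z + w) = 2^-1 *: (u + v).
  by apply/rowP => j; rewrite !mxE; field.
have uv : 0 < enorm (u - v).
  rewrite (_ : u - v = w - z); last by apply/rowP => j; rewrite !mxE; ring.
  by rewrite enorm_gt0 // subr_eq0 eq_sym.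
have le_mid : enorm (2^-1 *: (u + v)) <= (enorm u + enorm v) / 2.
  rewrite -(ler_pXn2r (n := 2)) ?nnegrE ?divr_ge0 ?addr_ge0 ?enorm_ge0 //.
  rewrite enorm_parallelogram; have := ler_dist_enorm u v.
  move=> uv_dist; have : (enorm u - enorm v) ^+ 2 <= enorm (u - v) ^+ 2.
    by rewrite -[leLHS]real_normK ?num_real // ler_pXn2r ?nnegrE ?enorm_ge0.
  move=> sqr_dist; rewrite -subr_ge0.
  rewrite (_ : _ - _ = (enorm (u - v) ^+ 2 - (enorm u - enorm v) ^+ 2) / 4).
    by rewrite divr_ge0 ?subr_ge0.
  by field.
have [uv_eq|uv_neq] := eqVneq (enorm u) (enorm v).
  rewrite uv_eq (_ : (_ + _) / 2 = enorm v `^ p); last by field.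
  apply: gt0_ltr_powR; rewrite ?nnegrE ?enorm_ge0 //.
  rewrite -(ltr_pXn2r (n := 2)) ?nnegrE ?enorm_ge0 // enorm_parallelogram uv_eq.
  rewrite (_ : (_ + _) / 2 = enorm v ^+ 2); last by field.
  by rewrite ltrBlDr ltrDl divr_gt0 ?exprn_gt0.
apply: le_lt_trans (ge0_ler_powR (ltW p_gt0) _ _ le_mid) _;
  rewrite ?nnegrE ?divr_ge0 ?addr_ge0 ?enorm_ge0 //.
move: uv_neq; rewrite neq_lt => /orP[uv_lt|uv_lt].
  by apply: powR_midpoint_lt => //; exact: enorm_ge0.
rewrite [enorm u + _]addrC [_ `^ p + _]addrC.
by apply: powR_midpoint_lt => //; exact: enorm_ge0.
Qed.

(** Doing at least as well as 0 bounds the term of index [i], hence the distance from [z] to the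
    [i]-th row. The radius is continuous in [x], so it also bounds minimizers locally uniformly. *)
Lemma enorm_le_dispersion x z i :
  dispersion p lambda x z <= dispersion p lambda x 0 ->
  enorm z <= enorm (row i x) + (dispersion p lambda x 0 / lambda i + 1).
Proof.
move=> zx; have := le_trans (dispersion_ge_term x z i) zx.
move/(powR_le_linear (ltW p_gt1) (lambda_gt0 i) (dispersion_ge0 x 0)) => tD.
have := enormD_le (z - row i x) (row i x); rewrite subrK enorm_subC => zt.
apply: le_trans zt _; rewrite addrC; exact: lerD.
Qed.

Lemma minimizers_dispersion x : minimizers setT (dispersion p lambda x) !=set0.
Proof.
have [i _] := i0P.
apply: (@coercive_minimizers _ _ _
  (enorm (row i x) + (dispersion p lambda x 0 / lambda i + 1))) => [|z zx k j].
  by apply: dispersion_continuous => t; [exact: cst_continuous|exact: cvg_id].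
rewrite ord1; exact: le_trans (coord_le_enorm _ _) (enorm_le_dispersion i zx).
Qed.

Lemma minimizers_dispersion_uniq x z w :
  minimizers setT (dispersion p lambda x) z ->
  minimizers setT (dispersion p lambda x) w -> z = w.
Proof. exact: midpoint_minimizers_uniq (@dispersion_midpoint_lt x). Qed.

Lemma barycenterP x : minimizers setT (dispersion p lambda x) (barycenter p lambda x).
Proof. exact: xgetPex (minimizers_dispersion x). Qed.

Lemma barycenter_uniq x z :
  minimizers setT (dispersion p lambda x) z -> barycenter p lambda x = z.
Proof. exact: minimizers_dispersion_uniq (barycenterP x). Qed.

Lemma barycenter_costE x :
  barycenter_cost p lambda x = dispersion p lambda x (barycenter p lambda x).
Proof. exact: minimumE (barycenterP x). Qed.

Lemma barycenter_cost_le x z : barycenter_cost p lambda x <= dispersion p lambda x z.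
Proof. by have [_ /(_ z Logic.I)] := barycenterP x; rewrite -barycenter_costE. Qed.

Lemma barycenter_cost_ge0 x : 0 <= barycenter_cost p lambda x.
Proof. by rewrite barycenter_costE dispersion_ge0. Qed.

Lemma barycenter_cost_eq x z :
  dispersion p lambda x z = barycenter_cost p lambda x -> barycenter p lambda x = z.
Proof.
move=> xz; apply: barycenter_uniq; split=> [|w _]; first exact: Logic.I.
rewrite xz; exact: barycenter_cost_le.
Qed.

Lemma barycenter_continuous :
  continuous (barycenter p lambda : 'M[R]_(N, d) -> 'rV[R]_d).
Proof.
(* Minimizers stay in a compact set locally, and a cluster point of minimizers is
   a minimizer of the limit problem, hence the barycenter by uniqueness. *)
have [i _] := i0P.
apply/continuous_closedP => F cF x0 clx0; set S := _ @^-1` F in clx0 *.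
pose r x := enorm (row i x) + (dispersion p lambda x 0 / lambda i + 1).
have rc : continuous r.
  have dc : continuous (fun x => dispersion p lambda x 0).
    by apply: dispersion_continuous => y; [exact: cvg_id|exact: cst_continuous].
  have ec : continuous (fun x => enorm (row i x)).
    by move=> x; apply: continuous_comp; [exact: row_continuous|exact: enorm_continuous].
  move=> x; have := @cvgD _ _ _ _ _ _ _ _ _ (ec x)
    (@cvgD _ _ _ _ _ _ _ _ _ (@cvgMl _ _ _ _ _ _ (lambda i)^-1 (dc x)) (cvg_cst (1 : R))).
  exact.
have WF : ProperFilter (within S (nbhs x0)) by exact: within_nbhs_proper.
have [|z0 [_ z0cl]] := @compact_cbox R 1 d (r x0 + 1)
    (barycenter p lambda @ within S (nbhs x0)) _.
(* By continuity of [r], all barycenters of points near [x0] lie in one cube. *)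
- have : \forall x \near x0, r x < r x0 + 1.
    by have /cvgr_lt/(_ (r x0 + 1)) := rc x0; apply; rewrite ltrDl.
  move=> rx0; suff: within S (nbhs x0)
    [set x | forall k j, `|(barycenter p lambda x : 'rV[R]_d) k j| <= r x0 + 1] by [].
  rewrite /within; apply: filterS rx0 => x rx Sx k j.
  rewrite ord1; apply: le_trans (coord_le_enorm _ _) _; apply: le_trans (ltW rx).
  have [_ bmin] := barycenterP x.
  exact: (enorm_le_dispersion i (bmin 0 Logic.I)).
have Fz0 : F z0.
  apply: cF => B z0B; apply: z0cl => //; exact: withinT.
rewrite /S /= (@barycenter_uniq x0 z0); first exact: Fz0.
split=> [|w _]; first exact: Logic.I.
rewrite leNgt; apply/negP => ww.
(* If [w] were strictly better than [z0] at [x0], then [h] would be positive near [(x0, z0)], so [w]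
   would beat the barycenter of some [x] in [S] near [x0]. *)
pose h (xz : 'M[R]_(N, d) * 'rV[R]_d) :=
  dispersion p lambda xz.1 xz.2 - dispersion p lambda xz.1 w.
have hc : continuous h.
  have fstc : continuous (@fst 'M[R]_(N, d) 'rV[R]_d) by move=> xz; exact: cvg_fst.
  have sndc : continuous (@snd 'M[R]_(N, d) 'rV[R]_d) by move=> xz; exact: cvg_snd.
  have constc : continuous (fun _ : 'M[R]_(N, d) * 'rV[R]_d => w).
    by move=> xz; exact: cst_continuous.
  have d1 := dispersion_continuous fstc sndc.
  have d2 := dispersion_continuous fstc constc.
  by move=> xz; exact: (cvgB (d1 xz) (d2 xz)).
have : \forall xz \near (x0, z0), 0 < h xz.
  by have /cvgr_gt/(_ 0) := hc (x0, z0); apply; rewrite subr_gt0.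
case=> -[A B] /= [x0A z0B] AB.
pose bary : 'M[R]_(N, d) -> 'rV[R]_d := barycenter p lambda.
have [y [[x [Ax Sx] <-] Bx]] : (bary @` (A `&` S) `&` B) !=set0.
  apply: z0cl => //; suff: within S (nbhs x0)
    [set x | (bary @` (A `&` S)) (barycenter p lambda x)] by [].
  by rewrite /within; apply: filterS x0A => x Ax Sx; exists x.
have := AB (x, barycenter p lambda x) (conj Ax Bx).
have [_ /(_ w Logic.I)] := barycenterP x.
by rewrite /h /= subr_gt0 ltNge => ->.
Qed.

Lemma barycenter_cost_continuous :
  continuous (barycenter_cost p lambda : 'M[R]_(N, d) -> R).
Proof.
have costE : (fun x : 'M[R]_(N, d) => dispersion p lambda x (barycenter p lambda x)) =
    barycenter_cost p lambda.
  by apply/funext => x; rewrite -barycenter_costE.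
rewrite -costE; apply: dispersion_continuous; last exact: barycenter_continuous.
by move=> x; exact: cvg_id.
Qed.

End barycenters.

(** * Transport costs *)

(** The difference of [f] and [g] is nonnegative with null integral, hence null almost everywhere;
    finiteness of the integral of [g] allows the cancellation. *)
Lemma integral_le_neq0 d (T : measurableType d) (R : realType)
    (P : probability T R) (f g : T -> R) :
  measurable_fun setT f -> measurable_fun setT g ->
  (forall x, 0 <= g x) -> (forall x, g x <= f x) ->
  (\int[P]_(x in setT) (f x)%:E <= \int[P]_(x in setT) (g x)%:E)%E ->
  (\int[P]_(x in setT) (g x)%:E < +oo)%E ->
  measurable [set x | f x != g x] /\ P [set x | f x != g x] = 0%E.
Proof.
move=> mf mg g0 gf fg gfin; pose h x := f x - g x.
have h0 x : 0 <= h x by rewrite subr_ge0.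
have mh : measurable_fun setT h by exact: measurable_funB.
have mhE : measurable_fun setT (fun x => (h x)%:E) by exact/measurable_EFinP.
have fE : (\int[P]_(x in setT) (f x)%:E =
    \int[P]_(x in setT) (g x)%:E + \int[P]_(x in setT) (h x)%:E)%E.
  rewrite -ge0_integralD //.
  - by apply: eq_integral => x _; rewrite -EFinD /h addrC subrK.
  - by move=> x _; rewrite lee_fin.
  - exact/measurable_EFinP.
  - by move=> x _; rewrite lee_fin.
have int_g0 : (0 <= \int[P]_(x in setT) (g x)%:E)%E.
  by apply: integral_ge0 => x _; rewrite lee_fin.
have int_h0 : (0 <= \int[P]_(x in setT) (h x)%:E)%E.
  by apply: integral_ge0 => x _; rewrite lee_fin.
have g_fin : (\int[P]_(x in setT) (g x)%:E)%E \is a fin_num by rewrite ge0_fin_numE.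
have h_eq0 : (\int[P]_(x in setT) `|(h x)%:E| = 0)%E.
  under eq_integral do rewrite gee0_abs ?lee_fin //.
  by apply/eqP; rewrite eq_le int_h0 andbT -(leeD2lE _ _ g_fin) adde0 -fE.
have ZE : [set x | f x != g x] = ~` (h @^-1` [set 0]).
  apply/seteqP; split=> x /=; first by rewrite /h => /eqP fgx /subr0_eq.
  by move=> hx; apply/negP => /eqP fgx; apply: hx; rewrite /h fgx subrr.
have mZ : measurable [set x | f x != g x].
  rewrite ZE; apply: measurableC; rewrite -[X in measurable X]setTI.
  by apply: mh => //; exact: measurable_set1.
split=> //; apply: measure_negligible => //.
have := (ae_eq_integral_abs P measurableT mhE).1 h_eq0.
apply: negligibleS => x /= fgx hx; move/negP: fgx; apply; apply/eqP/subr0_eq.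
by have [] := hx Logic.I.
Qed.

Lemma integral_law d d' (T : measurableType d) (T' : measurableType d')
    (R : realType) (P : probability T R) (Q : probability T' R) (f : T -> T')
    (h : T' -> R) :
  measurable_fun setT f -> (forall A, measurable A -> P (f @^-1` A) = Q A) ->
  measurable_fun setT h -> (forall y, 0 <= h y) ->
  (\int[Q]_(y in setT) (h y)%:E = \int[P]_(x in setT) (h (f x))%:E)%E.
Proof.
move=> mf PQ mh h0.
pose Pf : {measure set T' -> \bar R} :=
  distribution P (HB.pack f (isMeasurableFun.Build _ _ _ _ f mf) : {mfun T >-> T'}).
rewrite (@eq_measure_integral _ _ _ _ Pf); last first.
  by move=> A mA _; exact: esym (PQ A mA).
rewrite ge0_integral_pushforward //.
- exact/measurable_EFinP.
- by move=> y _; rewrite lee_fin.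
Qed.

Lemma measurable_row' (R : realType) (m d : nat) (i : 'I_m) :
  measurable_fun setT (row' i : borel_mx R m d -> borel_mx R m.-1 d).
Proof.
apply: measurable_to_mx => k j.
by under eq_fun do rewrite mxE; exact: measurable_coord.
Qed.

Lemma row_row' (T : Type) (m d : nat) (a : 'I_m) (i : 'I_m.-1) (x : 'M[T]_(m, d)) :
  row i (row' a x) = row (lift a i) x.
Proof. by apply/rowP => j; rewrite !mxE. Qed.

Lemma row'_cons_mx (T : Type) (m d : nat) (y : 'rV[T]_d) (x : 'M[T]_(m, d)) :
  row' ord0 (cons_mx y x) = x.
Proof. by apply/matrixP => i j; rewrite !mxE liftK. Qed.

Section transport.
Context (R : realType) (d : nat) (p : R).
Hypothesis p_gt1 : 1 < p.

Let p_neq0 : p != 0. Proof. by rewrite gt_eqF // (lt_trans _ p_gt1). Qed.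

Lemma transport_cost_continuous :
  continuous (fun x : 'M[R]_(2, d) => enorm (row 0 x - row 1 x) `^ p).
Proof.
apply: (@enorm_powR_continuous R d p p_gt1); apply: mx_continuous => k j x.
have -> : (fun y : 'M[R]_(2, d) => (row 0 y - row 1 y) k j) = (fun y => y 0 j - y 1 j).
  by apply/funext => y; rewrite !mxE.
exact: cvgB (@coord_continuous R 2 d 0 j x) (@coord_continuous R 2 d 1 j x).
Qed.

Let transport_cost (eta : probability (borel_mx R 2 d) R) : \bar R :=
  (\int[eta]_(x in [set: borel_mx R 2 d])
     (enorm (row 0 (x : 'M[R]_(2, d)) - row 1 (x : 'M[R]_(2, d))) `^ p)%:E)%E.

(** An optimal plan exists, so the minimum in the definition is a true one and not its default; the
    power [p] then cancels the root. *)
Lemma wasserstein_powE (mu rho : probability (borel_rV R d) R) :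
  exists2 eta, minimizers (couplings (tnth [tuple mu; rho])) transport_cost eta &
    (wasserstein p mu rho `^ p)%E = transport_cost eta.
Proof.
have pos (x : 'M[R]_(2, d)) : 0 <= enorm (row 0 x - row 1 x) `^ p.
  exact: powR_ge0.
have [eta eta_min] := minimizers_couplings transport_cost_continuous pos
  (couplings_nonempty (tnth [tuple mu; rho])).
exists eta => //; rewrite /wasserstein (minimumE _ eta_min) -poweRrM mulVf //.
by rewrite poweRe1 // integral_ge0 // => x _; rewrite lee_fin.
Qed.

Lemma wasserstein_optimal (mu rho : probability (borel_rV R d) R) :
  exists2 eta : probability (borel_mx R 2 d) R,
    couplings (tnth [tuple mu; rho]) eta &
    (wasserstein p mu rho `^ p)%E =
      (\int[eta]_(x in [set: borel_mx R 2 d])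
         (enorm (row 0 (x : 'M[R]_(2, d)) - row 1 (x : 'M[R]_(2, d))) `^ p)%:E)%E.
Proof. by have [eta [eta_c _] etaE] := wasserstein_powE mu rho; exists eta. Qed.

Lemma wasserstein_le (mu rho : probability (borel_rV R d) R)
    (eta : probability (borel_mx R 2 d) R) :
  couplings (tnth [tuple mu; rho]) eta ->
  (wasserstein p mu rho `^ p <=
     \int[eta]_(x in [set: borel_mx R 2 d])
       (enorm (row 0 (x : 'M[R]_(2, d)) - row 1 (x : 'M[R]_(2, d))) `^ p)%:E)%E.
Proof. by have [eta' [_ eta_min] ->] := wasserstein_powE mu rho; exact: eta_min. Qed.

Lemma measurable_transport_cost (m : nat) (a b : 'I_m) :
  measurable_fun setT (fun x : borel_mx R m d =>
    enorm (row a (x : 'M[R]_(m, d)) - row b (x : 'M[R]_(m, d))) `^ p).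
Proof.
apply: continuous_measurable_mx; apply: (@enorm_powR_continuous R d p p_gt1).
apply: mx_continuous => k j x.
have -> : (fun y : 'M[R]_(m, d) => (row a y - row b y) k j) = (fun y => y a j - y b j).
  by apply/funext => y; rewrite !mxE.
exact: cvgB (@coord_continuous R m d a j x) (@coord_continuous R m d b j x).
Qed.

Lemma integral_transport_cost (m : nat) (a b : 'I_m)
    (Gam : probability (borel_mx R m d) R) (eta : probability (borel_mx R 2 d) R) :
  (forall A, measurable A ->
    Gam ((rows2 a b : borel_mx R m d -> borel_mx R 2 d) @^-1` A) = eta A) ->
  (\int[eta]_(x in [set: borel_mx R 2 d])
     (enorm (row 0 (x : 'M[R]_(2, d)) - row 1 (x : 'M[R]_(2, d))) `^ p)%:E =
   \int[Gam]_(x in [set: borel_mx R m d])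
     (enorm (row a (x : 'M[R]_(m, d)) - row b (x : 'M[R]_(m, d))) `^ p)%:E)%E.
Proof.
move=> Gam_eta.
pose h (x : borel_mx R 2 d) :=
  enorm (row 0 (x : 'M[R]_(2, d)) - row 1 (x : 'M[R]_(2, d))) `^ p.
have mh : measurable_fun setT h by exact: measurable_transport_cost.
have h0 x : 0 <= h x by exact: powR_ge0.
apply: etrans (integral_law (@measurable_rows2 R m d a b) Gam_eta mh h0) _.
by apply: eq_integral => x _; rewrite /h row0_rows2 row1_rows2.
Qed.

Lemma couplings_rows2 (m : nat) (a b : 'I_m) (mu rho : probability (borel_rV R d) R)
    (Gam : probability (borel_mx R m d) R) (eta : probability (borel_mx R 2 d) R) :
  (forall A, measurable A ->
    Gam ((rows2 a b : borel_mx R m d -> borel_mx R 2 d) @^-1` A) = eta A) ->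
  (forall A, measurable A ->
    Gam ((row a : borel_mx R m d -> borel_rV R d) @^-1` A) = mu A) ->
  (forall A, measurable A ->
    Gam ((row b : borel_mx R m d -> borel_rV R d) @^-1` A) = rho A) ->
  couplings (tnth [tuple mu; rho]) eta.
Proof.
move=> Gam_eta Gam_mu Gam_rho i A mA.
rewrite /pushforward -Gam_eta; last exact: measurable_row_preimage.
have -> : i = (if i == 0 then 0 else 1) by apply: val_inj; case: i => [[|[|]]].
case: ifP => _.
  apply: etrans (Gam_mu A mA); congr (Gam _); apply/seteqP.
  by split=> x /=; rewrite row0_rows2.
apply: etrans (Gam_rho A mA); congr (Gam _); apply/seteqP.
by split=> x /=; rewrite row1_rows2.
Qed.

End transport.

(** * Integrated dispersion and the barycenter functional *)

Section multimarginal.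
Context (R : realType) (N d : nat) (p : R) (lambda : 'I_N -> R)
  (mu : 'I_N -> probability (borel_rV R d) R).
Hypotheses (p_gt1 : 1 < p) (lambda_gt0 : forall i, 0 < lambda i).

Lemma integral_dispersion d' (T : measurableType d') (P : probability T R)
    (f : T -> 'M[R]_(N, d)) (g : T -> 'rV[R]_d) (h : 'I_N -> T -> R) :
  (forall i t, enorm (row i (f t) - g t) `^ p = h i t) ->
  (forall i, measurable_fun setT (h i)) ->
  (\int[P]_(t in setT) (dispersion p lambda (f t) (g t))%:E =
   \sum_(i < N) (lambda i)%:E * \int[P]_(t in setT) (h i t)%:E)%E.
Proof.
move=> fgh mh.
have h0 i t : 0 <= h i t by rewrite -fgh; exact: powR_ge0.
have fghE t : dispersion p lambda (f t) (g t) = \sum_(i < N) lambda i * h i t.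
  by apply: eq_bigr => i _; rewrite fgh.
under eq_integral do rewrite fghE -sumEFin.
rewrite ge0_integral_sum //.
- apply: eq_bigr => i _; under eq_integral do rewrite EFinM.
  rewrite ge0_integralZl_EFin ?(ltW (lambda_gt0 i)) //.
    by move=> t _; rewrite lee_fin.
  exact/measurable_EFinP.
- move=> i; apply/measurable_EFinP; apply: measurable_funM; last exact: mh.
  exact: measurable_cst.
- by move=> i t _; rewrite lee_fin mulr_ge0 // ltW.
Qed.

Lemma integral_dispersion_rows (Gam : probability (borel_mx R N.+1 d) R) :
  (\int[Gam]_(x in [set: borel_mx R N.+1 d])
     (dispersion p lambda (row' ord0 (x : 'M[R]_(N.+1, d))) (row ord0 (x : 'M[R]_(N.+1, d))))%:E =
   \sum_(i < N) (lambda i)%:E * \int[Gam]_(x in [set: borel_mx R N.+1 d])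
     (enorm (row (lift ord0 i) (x : 'M[R]_(N.+1, d)) - row ord0 (x : 'M[R]_(N.+1, d))) `^ p)%:E)%E.
Proof.
apply: integral_dispersion => [i x|i]; last exact: measurable_transport_cost.
have xi : row i (row' ord0 x) = row (lift ord0 i) x by exact: row_row'.
by rewrite xi.
Qed.

(** Each row paired with row [ord0] has a law that couples [mu i] with [nu], hence costs at least
    the optimal amount. *)
Lemma barycenter_functional_le (nu : probability (borel_rV R d) R)
    (Gam : probability (borel_mx R N.+1 d) R) :
  (forall i S, measurable S ->
    Gam ((row (lift ord0 i) : borel_mx R N.+1 d -> borel_rV R d) @^-1` S) = mu i S) ->
  (forall S, measurable S ->
    Gam ((row ord0 : borel_mx R N.+1 d -> borel_rV R d) @^-1` S) = nu S) ->
  (barycenter_functional p lambda mu nu <=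
   \int[Gam]_(x in [set: borel_mx R N.+1 d])
     (dispersion p lambda (row' ord0 (x : 'M[R]_(N.+1, d))) (row ord0 (x : 'M[R]_(N.+1, d))))%:E)%E.
Proof.
move=> Gam_mu Gam_nu; rewrite integral_dispersion_rows.
apply: lee_sum => i _; apply: lee_wpmul2l; first by rewrite lee_fin ltW.
have [eta etaE] := push_probability Gam (@measurable_rows2 R N.+1 d (lift ord0 i) ord0).
have Gam_eta A : measurable A ->
    Gam ((rows2 (lift ord0 i) ord0 : borel_mx R N.+1 d -> borel_mx R 2 d) @^-1` A) = eta A.
  by move=> _; rewrite etaE.
have := wasserstein_le p_gt1 (couplings_rows2 Gam_eta (Gam_mu i) Gam_nu).
by rewrite (integral_transport_cost p_gt1 Gam_eta).
Qed.

(** Gluing optimal plans along their common marginal [nu] attains all the transport costs under one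
    joint law. *)
Lemma barycenter_functional_glue (nu : probability (borel_rV R d) R) :
  exists Gam : probability (borel_mx R N.+1 d) R,
    [/\ forall i S, measurable S ->
          Gam ((row (lift ord0 i) : borel_mx R N.+1 d -> borel_rV R d) @^-1` S) = mu i S,
        forall S, measurable S ->
          Gam ((row ord0 : borel_mx R N.+1 d -> borel_rV R d) @^-1` S) = nu S
      & barycenter_functional p lambda mu nu =
        (\int[Gam]_(x in [set: borel_mx R N.+1 d])
          (dispersion p lambda (row' ord0 (x : 'M[R]_(N.+1, d)))
             (row ord0 (x : 'M[R]_(N.+1, d))))%:E)%E].
Proof.
have /choice[eta etaP] (i : 'I_N) : exists eta : probability (borel_mx R 2 d) R,
    couplings (tnth [tuple mu i; nu]) eta /\
    (wasserstein p (mu i) nu `^ p)%E =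
      (\int[eta]_(x in [set: borel_mx R 2 d])
         (enorm (row 0 (x : 'M[R]_(2, d)) - row 1 (x : 'M[R]_(2, d))) `^ p)%:E)%E.
  by have [eta] := wasserstein_optimal p_gt1 (mu i) nu; exists eta.
have eta_nu i S : measurable S ->
    eta i ((row 1 : borel_mx R 2 d -> borel_rV R d) @^-1` S) = nu S.
  by move=> mS; have [eta_c _] := etaP i; exact: eta_c 1 S mS.
have [Gam Gam_nu Gam_eta] := gluing eta_nu.
exists Gam; split=> // [i S mS|].
  have [eta_c _] := etaP i.
  apply: etrans (etrans (Gam_eta i _ (measurable_row_preimage 0 mS)) (eta_c 0 S mS)).
  by congr (Gam _); apply/seteqP; split=> x /=; rewrite row0_rows2.
rewrite integral_dispersion_rows; apply: eq_bigr => i _.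
have [_ ->] := etaP i; apply: (congr1 (fun v => (lambda i)%:E * v)%E).
exact: integral_transport_cost (Gam_eta i).
Qed.

End multimarginal.

(** The sum is at most twice the larger number. *)
Lemma powRD_le (R : realType) (p a b : R) : 0 < p -> 0 <= a -> 0 <= b ->
  (a + b) `^ p <= 2 `^ p * (a `^ p + b `^ p).
Proof.
move=> p0; wlog ab : a b / a <= b => [th a0 b0|a0 b0].
  have [/th|/ltW/th] := leP a b; first exact.
  by rewrite addrC [b `^ p + _]addrC; exact.
apply: (@le_trans _ _ ((2 * b) `^ p)).
  by apply: ge0_ler_powR; rewrite ?nnegrE ?addr_ge0 ?mulr_ge0 ?(ltW p0) // mulr_natl mulr2n lerD2r.
by rewrite powRM // ler_wpM2l ?powR_ge0 // lerDr powR_ge0.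
Qed.

(** * Passing between couplings and candidate barycenters *)

Section barycenter_problem.
Context (R : realType) (N d : nat) (p : R) (lambda : 'I_N -> R)
  (mu : 'I_N -> probability (borel_rV R d) R).
Hypotheses (p_gt1 : 1 < p) (lambda_gt0 : forall i, 0 < lambda i)
  (lambda_sum1 : \sum_(i < N) lambda i = 1)
  (mu_moment : forall i, finite_moment p (mu i)).

Let p_gt0 : 0 < p. Proof. exact: lt_trans p_gt1. Qed.

Let bary := (barycenter p lambda : 'M[R]_(N, d) -> 'rV[R]_d).

Let measurable_bary : measurable_fun setT (bary : borel_mx R N d -> borel_rV R d).
Proof.
by apply: continuous_measurable_mx2; exact: barycenter_continuous p_gt1 lambda_gt0 lambda_sum1.
Qed.

Let measurable_cost :
  measurable_fun setT (barycenter_cost p lambda : borel_mx R N d -> R).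
Proof.
by apply: continuous_measurable_mx; exact: barycenter_cost_continuous p_gt1 lambda_gt0 lambda_sum1.
Qed.

Let measurable_enorm_powR : measurable_fun setT (fun y : borel_rV R d => enorm (y : 'rV[R]_d) `^ p).
Proof.
apply: (@continuous_measurable_mx R 1 d (fun y => enorm y `^ p)).
by apply: enorm_powR_continuous => // y; exact: cvg_id.
Qed.

Let measurable_enorm_row i :
  measurable_fun setT (fun x : borel_mx R N d => enorm (row i (x : 'M[R]_(N, d))) `^ p).
Proof.
apply: (@continuous_measurable_mx R N d (fun y => enorm (row i y) `^ p)).
by apply: enorm_powR_continuous => //; exact: row_continuous.
Qed.

Let measurable_dispersion0 :
  measurable_fun setT (fun x : borel_mx R N d => dispersion p lambda (x : 'M[R]_(N, d)) 0).
Proof.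
apply: (@continuous_measurable_mx R N d (fun y => dispersion p lambda y 0)).
apply: dispersion_continuous => // y; first exact: cvg_id.
exact: cst_continuous.
Qed.

Lemma coupling_moment (gam : probability (borel_mx R N d) R) i :
  couplings mu gam ->
  (\int[gam]_(x in [set: borel_mx R N d]) (enorm (row i (x : 'M[R]_(N, d))) `^ p)%:E < +oo)%E.
Proof.
move=> gam_mu; have := mu_moment i; rewrite /finite_moment /=.
rewrite (@integral_law _ _ _ _ R gam (mu i) (row i : borel_mx R N d -> borel_rV R d)
  (fun y => enorm (y : 'rV[R]_d) `^ p)) //.
- exact: measurable_row.
- by move=> A; exact: gam_mu.
- by move=> y; exact: powR_ge0.
Qed.

(** Dispersion around 0 integrates to a weighted sum of the [p]-th moments of the marginals. It
    dominates the barycenter cost. *)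
Lemma dispersion0_integral (gam : probability (borel_mx R N d) R) :
  couplings mu gam ->
  (\int[gam]_(x in [set: borel_mx R N d])
     (dispersion p lambda (x : 'M[R]_(N, d)) 0)%:E < +oo)%E.
Proof.
move=> gam_mu.
pose rowp i (x : borel_mx R N d) := enorm (row i (x : 'M[R]_(N, d))) `^ p.
have rowpE i x : enorm (row i (x : 'M[R]_(N, d)) - 0) `^ p = rowp i x.
  by rewrite subr0.
rewrite (integral_dispersion lambda_gt0 gam rowpE measurable_enorm_row).
apply: lte_sum_pinfty => i _; apply: lte_mul_pinfty => //.
  by rewrite lee_fin ltW.
exact: coupling_moment.
Qed.

Lemma multimarginal_cost_fin (gam : probability (borel_mx R N d) R) :
  couplings mu gam -> (multimarginal_cost p lambda gam < +oo)%E.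
Proof.
move=> /dispersion0_integral; apply: le_lt_trans; apply: ge0_le_integral.
- exact: measurableT.
- by move=> x _; rewrite lee_fin; exact: barycenter_cost_ge0 p_gt1 lambda_gt0 lambda_sum1 x.
- by apply/measurable_EFinP; exact: measurable_cost.
- by apply/measurable_EFinP; exact: measurable_dispersion0.
- by move=> x _; rewrite lee_fin; exact: barycenter_cost_le p_gt1 lambda_gt0 lambda_sum1 x 0.
Qed.

(** The barycenter is as far from 0 as row [i] plus their distance, whose [p]-th power is at most
    the minimal dispersion divided by [lambda i]. Dispersion around 0 bounds the minimal one and is
    integrable. *)
Lemma barycenter_moment (gam : probability (borel_mx R N d) R)
    (nu : probability (borel_rV R d) R) :
  couplings mu gam ->
  (forall A, measurable A -> nu A = gam ((bary : borel_mx R N d -> borel_rV R d) @^-1` A)) ->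
  finite_moment p nu.
Proof.
move=> gam_mu nuE; have [i _] : exists i : 'I_N, True.
  case: N lambda lambda_sum1 => [|n] l l1; last by exists ord0.
  by move/eqP: l1; rewrite big_ord0 eq_sym oner_eq0.
have gam_nu A : measurable A ->
    gam ((bary : borel_mx R N d -> borel_rV R d) @^-1` A) = nu A.
  by move=> /nuE ->.
rewrite /finite_moment /= (integral_law measurable_bary gam_nu measurable_enorm_powR); last first.
  by move=> y; exact: powR_ge0.
have bary_le (x : 'M[R]_(N, d)) : enorm (bary x) `^ p <=
    2 `^ p * enorm (row i x) `^ p + 2 `^ p / lambda i * dispersion p lambda x 0.
  apply: (@le_trans _ _ ((enorm (row i x) + enorm (row i x - bary x)) `^ p)).
    apply: ge0_ler_powR; rewrite ?nnegrE ?addr_ge0 ?enorm_ge0 ?(ltW p_gt0) //.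
    rewrite addrC enorm_subC; have := enormD_le (bary x - row i x) (row i x).
    by rewrite subrK.
  apply: le_trans (powRD_le _ _ _) _; rewrite ?enorm_ge0 //.
  rewrite mulrDr lerD2l -mulrA; apply: ler_wpM2l; first exact: powR_ge0.
  rewrite mulrC ler_pdivlMr // mulrC.
  apply: (@le_trans _ _ (dispersion p lambda x (bary x))).
    exact: dispersion_ge_term.
  by have [_ /(_ 0 Logic.I)] := barycenterP p_gt1 lambda_gt0 lambda_sum1 x.
pose A : R := 2 `^ p; pose B : R := 2 `^ p / lambda i.
have A0 : 0 <= A by exact: powR_ge0.
have B0 : 0 <= B by rewrite divr_ge0 // ltW.
apply: (@le_lt_trans _ _ (\int[gam]_(x in [set: borel_mx R N d])
  (A%:E * (enorm (row i (x : 'M[R]_(N, d))) `^ p)%:E +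
   B%:E * (dispersion p lambda (x : 'M[R]_(N, d)) 0)%:E))%E).
  apply: ge0_le_integral.
  - exact: measurableT.
  - by move=> x _; rewrite lee_fin powR_ge0.
  - apply/measurable_EFinP; exact: (measurableT_comp measurable_enorm_powR measurable_bary).
  - apply/measurable_EFinP; apply: measurable_funD; apply: measurable_funM; by
      [exact: measurable_cst|exact: measurable_enorm_row|exact: measurable_dispersion0].
  - by move=> x _; rewrite -!EFinM -EFinD lee_fin; exact: bary_le.
have ge0_row x : (0 <= (enorm (row i (x : 'M[R]_(N, d))) `^ p)%:E)%E.
  by rewrite lee_fin powR_ge0.
have ge0_disp x : (0 <= (dispersion p lambda (x : 'M[R]_(N, d)) 0)%:E)%E.
  by rewrite lee_fin; exact: dispersion_ge0.
have mrow := measurable_enorm_row i.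
rewrite ge0_integralD //.
- rewrite !ge0_integralZl_EFin //.
  + apply: lte_add_pinfty; apply: lte_mul_pinfty; rewrite ?lee_fin //.
      exact: coupling_moment.
    exact: dispersion0_integral.
  + exact/measurable_EFinP.
  + exact/measurable_EFinP.
- by move=> x _; apply: mule_ge0; rewrite ?lee_fin //; exact: ge0_row.
- by apply/measurable_EFinP; apply: measurable_funM => //; exact: measurable_cst.
- by move=> x _; apply: mule_ge0; rewrite ?lee_fin //; exact: ge0_disp.
- by apply/measurable_EFinP; apply: measurable_funM => //; exact: measurable_cst.
Qed.

Let row'_continuous : continuous (row' ord0 : 'M[R]_(N.+1, d) -> 'M[R]_(N, d)).
Proof.
apply: mx_continuous => i j x.
have -> : (fun y : 'M[R]_(N.+1, d) => row' ord0 y i j) = (fun y => y (lift ord0 i) j).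
  by apply/funext => y; rewrite mxE.
exact: coord_continuous.
Qed.

(** Row [ord0] plays the candidate center, the other rows the points. *)
Let joint (X : borel_mx R N.+1 d) : R :=
  dispersion p lambda (row' ord0 (X : 'M[R]_(N.+1, d))) (row ord0 (X : 'M[R]_(N.+1, d))).

Let joint_ge0 X : 0 <= joint X.
Proof. exact: dispersion_ge0. Qed.

Let measurable_joint : measurable_fun setT joint.
Proof.
apply: (@continuous_measurable_mx R N.+1 d
  (fun X => dispersion p lambda (row' ord0 X) (row ord0 X))).
by apply: dispersion_continuous; [|exact: row'_continuous|exact: row_continuous].
Qed.

(** The joint law of the barycenter of [x] and of [x] has the right row laws, and on its support the
    dispersion equals the barycenter cost. *)
Lemma barycenter_functional_push (gam : probability (borel_mx R N d) R)
    (nu : probability (borel_rV R d) R) :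
  couplings mu gam ->
  (forall A, measurable A -> nu A = gam ((bary : borel_mx R N d -> borel_rV R d) @^-1` A)) ->
  (barycenter_functional p lambda mu nu <= multimarginal_cost p lambda gam)%E.
Proof.
move=> gam_mu nuE.
pose G (x : borel_mx R N d) : borel_mx R N.+1 d := cons_mx (bary x) (x : 'M[R]_(N, d)).
have mG : measurable_fun setT G.
  apply: measurable_to_mx => i j; rewrite /G /cons_mx.
  under eq_fun do rewrite mxE; case: unlift => [k|]; first exact: measurable_coord.
  exact: (measurableT_comp (@measurable_coord R 1 d 0 j) measurable_bary).
have [Gam GamE] := push_probability gam mG.
have Gam_mu i S : measurable S ->
    Gam ((row (lift ord0 i) : borel_mx R N.+1 d -> borel_rV R d) @^-1` S) = mu i S.
  move=> mS; rewrite GamE; apply: etrans (gam_mu i S mS).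
  by congr (gam _); apply/seteqP; split=> x /=; rewrite /G row_cons_mxS.
have Gam_nu S : measurable S ->
    Gam ((row ord0 : borel_mx R N.+1 d -> borel_rV R d) @^-1` S) = nu S.
  move=> mS; rewrite GamE nuE //.
  by congr (gam _); apply/seteqP; split=> x /=; rewrite /G row_cons_mx0.
apply: le_trans (barycenter_functional_le p_gt1 lambda_gt0 Gam_mu Gam_nu) _.
have GamE' A : measurable A -> gam (G @^-1` A) = Gam A by move=> _; rewrite GamE.
have -> := integral_law mG GamE' measurable_joint joint_ge0.
have costE x : joint (G x) = barycenter_cost p lambda x.
  rewrite /joint /G row'_cons_mx row_cons_mx0.
  by rewrite (barycenter_costE p_gt1 lambda_gt0 lambda_sum1).
by under eq_integral do rewrite costE.
Qed.

(** Dropping the center from the glued plan leaves a coupling [gam]. Both functionals become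
    integrals against the same [Gam], so that their integrands can be compared pointwise. *)
Lemma barycenter_functional_tail (nu : probability (borel_rV R d) R) :
  exists (gam : probability (borel_mx R N d) R) (Gam : probability (borel_mx R N.+1 d) R),
    [/\ couplings mu gam,
        forall A, measurable A ->
          Gam ((row' ord0 : borel_mx R N.+1 d -> borel_mx R N d) @^-1` A) = gam A,
        forall S, measurable S ->
          Gam ((row ord0 : borel_mx R N.+1 d -> borel_rV R d) @^-1` S) = nu S,
        barycenter_functional p lambda mu nu =
          (\int[Gam]_(x in [set: borel_mx R N.+1 d]) (joint x)%:E)%E
      & multimarginal_cost p lambda gam =
          (\int[Gam]_(x in [set: borel_mx R N.+1 d])
             (barycenter_cost p lambda (row' ord0 (x : 'M[R]_(N.+1, d))))%:E)%E].
Proof.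
have [Gam [Gam_mu Gam_nu FE]] :=
  barycenter_functional_glue mu p_gt1 lambda_gt0 nu.
have [gam gamE] := push_probability Gam (@measurable_row' R N.+1 d ord0).
have Gam_gam A : measurable A ->
    Gam ((row' ord0 : borel_mx R N.+1 d -> borel_mx R N d) @^-1` A) = gam A.
  by move=> _; rewrite gamE.
exists gam, Gam; split=> //.
  move=> i S mS; rewrite /pushforward gamE; apply: etrans (Gam_mu i S mS).
  have rowE (x : 'M[R]_(N.+1, d)) : row i (row' ord0 x) = row (lift ord0 i) x.
    exact: row_row'.
  by congr (Gam _); apply/seteqP; split=> x /=; rewrite rowE.
have cost_ge0 x : 0 <= barycenter_cost p lambda (x : 'M[R]_(N, d)).
  exact: barycenter_cost_ge0.
exact: integral_law (@measurable_row' R N.+1 d ord0) Gam_gam measurable_cost cost_ge0.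
Qed.

(** Equal finite integrals force the dispersion around row [ord0] to be minimal outside a null set
    [Z]; there the center is the barycenter by uniqueness of minimizers. *)
Lemma barycenter_ae (gam : probability (borel_mx R N d) R)
    (Gam : probability (borel_mx R N.+1 d) R) :
  (forall A, measurable A ->
    Gam ((row' ord0 : borel_mx R N.+1 d -> borel_mx R N d) @^-1` A) = gam A) ->
  (\int[Gam]_(x in [set: borel_mx R N.+1 d]) (joint x)%:E <=
     \int[Gam]_(x in [set: borel_mx R N.+1 d])
       (barycenter_cost p lambda (row' ord0 (x : 'M[R]_(N.+1, d))))%:E)%E ->
  (\int[Gam]_(x in [set: borel_mx R N.+1 d]) (joint x)%:E < +oo)%E ->
  forall S, measurable S ->
    Gam ((row ord0 : borel_mx R N.+1 d -> borel_rV R d) @^-1` S) =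
    gam ((bary : borel_mx R N d -> borel_rV R d) @^-1` S).
Proof.
move=> Gam_gam le_joint joint_fin S mS.
pose cost (X : borel_mx R N.+1 d) : R :=
  barycenter_cost p lambda (row' ord0 (X : 'M[R]_(N.+1, d))).
have mcost : measurable_fun setT cost.
  exact: (measurableT_comp measurable_cost (@measurable_row' R N.+1 d ord0)).
have cost_ge0 X : 0 <= cost X by exact: barycenter_cost_ge0.
have cost_le X : cost X <= joint X by exact: barycenter_cost_le.
have cost_fin : (\int[Gam]_(x in [set: borel_mx R N.+1 d]) (cost x)%:E < +oo)%E.
  apply: le_lt_trans joint_fin; apply: ge0_le_integral => //.
  - by move=> x _; rewrite lee_fin.
  - exact/measurable_EFinP.
  - exact/measurable_EFinP.
  - by move=> x _; rewrite lee_fin.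
have [] := integral_le_neq0 measurable_joint mcost cost_ge0 cost_le le_joint cost_fin.
set Z := [set X | joint X != cost X] => mZ Z0.
have mrow := measurable_row_preimage (ord0 : 'I_N.+1) mS.
have mbary : measurable ((bary : borel_mx R N d -> borel_rV R d) @^-1` S).
  by rewrite -[X in measurable X]setTI; exact: measurable_bary.
have mrow' : measurable ((row' ord0 : borel_mx R N.+1 d -> borel_mx R N d) @^-1`
    ((bary : borel_mx R N d -> borel_rV R d) @^-1` S)).
  by rewrite -[X in measurable X]setTI; exact: (@measurable_row' R N.+1 d ord0).
apply: etrans (Gam_gam _ mbary).
have cutZ A : measurable A -> Gam A = Gam (A `&` ~` Z).
  move=> mA; apply: etrans (measure_splitI Gam mA mZ) _.
  by rewrite (measure_null_sub (measurableI _ _ mA mZ) mZ _ Z0) ?add0e.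
rewrite (cutZ _ mrow) (cutZ _ mrow'); congr (Gam _).
have baryE X : (~` Z) X -> bary (row' ord0 X) = row ord0 X.
  by move=> /negP/negPn/eqP; exact: barycenter_cost_eq.
by apply/seteqP; split=> X [XS nZ]; split=> //; move: XS; rewrite /= baryE.
Qed.

Lemma multimarginal_cost_le (nu : probability (borel_rV R d) R) :
  exists gam : probability (borel_mx R N d) R,
    [/\ couplings mu gam,
        (multimarginal_cost p lambda gam <= barycenter_functional p lambda mu nu)%E
      & (barycenter_functional p lambda mu nu <= multimarginal_cost p lambda gam)%E ->
        forall A, measurable A ->
          nu A = gam ((bary : borel_mx R N d -> borel_rV R d) @^-1` A)].
Proof.
have [gam [Gam [gam_mu Gam_gam Gam_nu FE JE]]] := barycenter_functional_tail nu.
exists gam; split=> //.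
- rewrite JE FE; apply: ge0_le_integral.
  + exact: measurableT.
  + by move=> x _; rewrite lee_fin; exact: barycenter_cost_ge0.
  + apply/measurable_EFinP.
    exact: (measurableT_comp measurable_cost (@measurable_row' R N.+1 d ord0)).
  + exact/measurable_EFinP.
  + by move=> x _; rewrite lee_fin; exact: barycenter_cost_le.
- move=> FJ A mA; rewrite -Gam_nu //; apply: barycenter_ae => //.
    by rewrite -FE -JE.
  (* Finiteness comes from the multimarginal side, where the moments of the marginals bound the cost
     of any coupling. *)
  by rewrite -FE; apply: le_lt_trans FJ _; exact: multimarginal_cost_fin.
Qed.

End barycenter_problem.

(** * Equality of the minima and correspondence of the minimizers *)

Theorem proposition1p1 (R : realType) (N d : nat) (p : R) (lambda : 'I_N -> R)
    (mu : 'I_N -> probability (borel_rV R d) R)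
    (p_gt1 : 1 < p)
    (lambda_gt0 : forall i, 0 < lambda i)
    (lambda_sum1 : \sum_(i < N) lambda i = 1)
    (mu_moment : forall i, finite_moment p (mu i)) :
  [/\ minimizers (couplings mu) (multimarginal_cost p lambda) !=set0,
      minimizers (finite_moment p) (barycenter_functional p lambda mu) !=set0,
      minimum +oo%E (couplings mu) (multimarginal_cost p lambda) =
        minimum +oo%E (finite_moment p) (barycenter_functional p lambda mu)
    & forall nu : probability (borel_rV R d) R,
        minimizers (finite_moment p) (barycenter_functional p lambda mu) nu <->
        exists2 gamma : probability (borel_mx R N d) R,
          minimizers (couplings mu) (multimarginal_cost p lambda) gamma
        & forall A : set (borel_rV R d), measurable A ->
            nu A = pushforward gamma (barycenter p lambda) A].
Proof.
pose J := multimarginal_cost p lambda (d := d).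
pose F := barycenter_functional p lambda mu.
have cost_c := @barycenter_cost_continuous R N d p lambda p_gt1 lambda_gt0 lambda_sum1.
have cost_ge0 := @barycenter_cost_ge0 R N d p lambda p_gt1 lambda_gt0 lambda_sum1.
have [gam0 gam0_min] := minimizers_couplings cost_c cost_ge0 (couplings_nonempty mu).
have mbary : measurable_fun setT (barycenter p lambda : borel_mx R N d -> borel_rV R d).
  apply: continuous_measurable_mx2; exact: barycenter_continuous.
have push_min (gam : probability (borel_mx R N d) R) (nu : probability (borel_rV R d) R) :
    couplings mu gam ->
    (forall A, measurable A -> nu A = pushforward gam (barycenter p lambda) A) ->
    finite_moment p nu /\ (F nu <= J gam)%E.
  move=> gam_mu nuE; split; first exact: barycenter_moment gam_mu nuE.
  exact: barycenter_functional_push gam_mu nuE.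
(* The push-forward [nu0] of an optimal coupling is a candidate of value at most [J gam0]; since
   [J gam0] bounds [F] from below, it is optimal and the minima agree. *)
have [nu0 nu0E] := push_probability gam0 mbary.
have [nu0_moment nu0_le] : finite_moment p nu0 /\ (F nu0 <= J gam0)%E.
  by apply: push_min; [exact: gam0_min.1|move=> A _; exact: nu0E].
have tail_le := multimarginal_cost_le p_gt1 lambda_gt0 lambda_sum1 mu_moment.
have le_F nu : (J gam0 <= F nu)%E.
  by have [gam [gam_mu gam_le _]] := tail_le nu; apply: le_trans gam_le; exact: gam0_min.2.
have nu0_min : minimizers (finite_moment p) F nu0.
  by split=> // nu _; exact: le_trans nu0_le (le_F nu).
split.
- by exists gam0.
- by exists nu0.
- rewrite (minimumE _ nu0_min) (minimumE (f := J) _ gam0_min).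
  by apply: le_anti; rewrite le_F nu0_le.
move=> nu; split=> [[nu_moment nu_min]|[gam [gam_mu gam_min] nuE]].
  have [gam [gam_mu gam_le nuE]] := tail_le nu.
  (* The chain [J gam <= F nu <= J gam0 <= J gam] makes [gam] optimal and triggers the equality
     case, which identifies [nu] as its push-forward. *)
  have nu_le : (F nu <= J gam0)%E by apply: le_trans nu0_le; exact: nu_min.
  exists gam.
    split=> // gam' /gam0_min.2; apply: le_trans; exact: le_trans gam_le nu_le.
  by apply: nuE; apply: le_trans nu_le _; exact: gam0_min.2.
(* Conversely, [F nu <= J gam <= J gam0 <= F nu'] for every competitor [nu']. *)
have [nu_moment nu_le] := push_min gam nu gam_mu nuE.
split=> // nu' _; apply: le_trans nu_le _; apply: le_trans (le_F nu').
exact: gam_min gam0_min.1.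
Qed.
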